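(* Let the Belavin-Drinfeld triple $(\Gamma_1,\Gamma_2,\tau)$ of type $A_{n-1}$ be a $\tau$-orthogonal union of Belavin-Drinfeld triples $(\Gamma_1^{(i)},\Gamma_2^{(i)},\tau^{(i)})$ of type $A_{n-1}$. Then the GGS conjecture holds for $(\Gamma_1,\Gamma_2,\tau)$ if and only if it holds for each $(\Gamma_1^{(i)},\Gamma_2^{(i)},\tau^{(i)})$; and the twist conjecture holds for $(\Gamma_1,\Gamma_2,\tau)$ if and only if it holds for each $(\Gamma_1^{(i)},\Gamma_2^{(i)},\tau^{(i)})$.
   Context: Roots and triples. Fix $n\ge2$. Let $(e_i)_{1\le i\le n}$ be the standard basis of $\mathbb C^n$, $(\,,\,)$ the bilinear inner product for which it is orthonormal (and $\perp$ the corresponding orthogonality), $\alpha_i=e_i-e_{i+1}$, $\Gamma=\{\alpha_1,\dots,\alpha_{n-1}\}$. A Belavin-Drinfeld triple of type $A_{n-1}$ is $(\Gamma_1,\Gamma_2,\tau)$ with $\Gamma_1,\Gamma_2\subset\Gamma$ and $\tau:\Gamma_1\to\Gamma_2$ a bijection such that $(\tau\alpha,\tau\beta)=(\alpha,\beta)$ for all $\alpha,\beta\in\Gamma_1$, and for every $\alpha\in\Gamma_1$ there is $k\in\mathbb N$ with $\tau^k\alpha\notin\Gamma_1$. Let $e_{ij}$ be the matrix units. For $\alpha=e_i-e_j$ ($i\ne j$) put $e_\alpha=e_{ij}$, $|\alpha|=|j-i|$, and $\alpha>0$ iff $i<j$. For $Y\subset\Gamma$ let $\tilde Y$ be the set of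 $v\in\mathrm{Span}(Y)$ of the form $v=e_i-e_j$ with $i<j$. Extend $\tau$ additively to $\tilde\Gamma_1\to\tilde\Gamma_2$. Write $\alpha\prec\beta$ if $\beta=\tau^p\alpha$ for some $p\ge1$. If $\alpha\prec\beta=\tau^p\alpha$ with $\alpha=e_j-e_i$, $\beta=e_k-e_{k+i-j}$, $i-j\ge2$, write $\alpha\prec^{\leftarrow}\beta$ if $\tau^p\alpha_j=\alpha_{k+i-j-1}$, and $\alpha\prec^{\rightarrow}\beta$ if $\tau^p\alpha_j=\alpha_k$. Put $\mathrm{sign}(\alpha,\beta)=(-1)^{1-|\alpha|}$ if $\alpha\prec^{\leftarrow}\beta$, and $\mathrm{sign}(\alpha,\beta)=1$ if $\alpha\prec^{\rightarrow}\beta$ or $|\alpha|=1$. For positive roots, $e_i-e_j\lessdot e_k-e_l$ means $j=k$, and $\alpha\gtrdot\beta$ means $\beta\lessdot\alpha$. $[\text{statement}]$ is $1$ if the statement is true, $0$ otherwise. Unions. $(\Gamma_1,\Gamma_2,\tau)=\bigcup_i(\Gamma_1^{(i)},\Gamma_2^{(i)},\tau^{(i)})$ means $\Gamma_1=\bigcup\Gamma_1^{(i)}$, $\Gamma_2=\bigcup\Gamma_2^{(i)}$ and $\tau|_{\Gamma_1^{(i)}}=\tau^{(i)}$. The union is orthogonal if $\Gamma_1^{(i)}\perp\Gamma_1^{(j)}$ and $\Gamma_2^{(i)}\perp\Gamma_2^{(j)}$ for $i\ne j$, and $\tau$-orthogonal if in addition $\Gamma_2^{(i)}\cap\Gamma_1\subset\Gamma_1^{(i)}$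 for all $i$. The matrix $R_{\mathrm{GGS}}$. Let $\mathfrak h$ be the diagonal matrices, with $e_i(e_{jj})=\delta_{ij}$. Let $P=\sum_{i,j}e_{ij}\otimes e_{ji}$, $P^0=\sum_ie_{ii}\otimes e_{ii}$, $x\wedge y=x\otimes y-y\otimes x$. Consider for $r^0\in\mathfrak h\wedge\mathfrak h$ the equation $$[(\alpha-\tau\alpha)\otimes1]\,r^0=\tfrac12[(\alpha+\tau\alpha)\otimes1]\,P^0\quad\text{for all }\alpha\in\Gamma_1.\qquad( * )$$ Set $q=e^\hbar$ ($\hbar$ formal; $q^x=\exp(\hbar x)$), and $$a=\sum_{\alpha\prec\beta}\mathrm{sign}(\alpha,\beta)\,e_{-\alpha}\wedge e_\beta,\quad r_s=\tfrac12P^0+\sum_{\alpha>0}e_{-\alpha}\otimes e_\alpha,\quad \epsilon=ar_s+r_sa+a^2,$$ $$R_s=q\sum_i e_{ii}\otimes e_{ii}+\sum_{i\ne j}e_{ii}\otimes e_{jj}+(q-q^{-1})\sum_{i>j}e_{ij}\otimes e_{ji}.$$ Writing $z=\sum z_{ik}^{jl}e_{ij}\otimes e_{kl}$, set $\tilde a=\sum a_{ik}^{jl}q^{a_{ik}^{jl}\epsilon_{ik}^{jl}}e_{ij}\otimes e_{kl}$, $\bar R_{\mathrm{GGS}}=R_s+(q-q^{-1})\tilde a$ and $R_{\mathrm{GGS}}=q^{r^0}\bar R_{\mathrm{GGS}}q^{r^0}$. The matrix $R_J$. For $\alpha\prec\beta$ let $$K_{\alpha,\beta}=\tfrac12[\alpha\lessdot\beta]-\tfrac12[\alpha\gtrdot\beta]+[\exists\gamma:\alpha\prec\gamma\prec\beta,\alpha\lessdot\gamma]-[\exists\gamma:\alpha\prec\gamma\prec\beta,\alpha\gtrdot\gamma]+[\alpha\prec^{\leftarrow}\beta](1-|\alpha|),$$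 and for $p\ge1$ $$A^p=(q-q^{-1})\sum_{\beta=\tau^p(\alpha)}\mathrm{sign}(\alpha,\beta)q^{K_{\alpha,\beta}}e_\beta\otimes e_{-\alpha},\quad J^p=1+A^p,\quad J=J^1J^2\cdots J^d,$$ where $d$ is the largest $p$ for which $\tau^p$ is defined on some element of $\tilde\Gamma_1$ (if $\Gamma_1=\emptyset$, $J=1$). Set $\bar R_J=J^{-1}R_sJ_{21}$ and $R_J=q^{r^0}\bar R_Jq^{r^0}$, where the subscript $21$ denotes exchanging tensor factors. The conjectures. The quantum Yang-Baxter equation (QYBE) is $R_{12}R_{13}R_{23}=R_{23}R_{13}R_{12}$; the Hecke relation is $(PR-q)(PR+q^{-1})=0$. The GGS conjecture holds for a triple if, for every $r^0\in\mathfrak h\wedge\mathfrak h$ solving ( * ) for that triple, $R_{\mathrm{GGS}}$ satisfies the QYBE and the Hecke relation. The twist conjecture holds for a triple if, for every such $r^0$, $R_J$ satisfies the QYBE and $R_J=R_{\mathrm{GGS}}$. *)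

(* Defs.v *)
From HB Require Import structures.
From mathcomp Require Import all_boot all_order all_algebra.
From mathcomp Require Import boolp classical_sets reals.
From mathcomp Require Import complex mxtens.

Set Implicit Arguments.
Unset Strict Implicit.
Unset Printing Implicit Defensive.

Import Order.TTheory GRing.Theory Num.Theory.
Local Open Scope ring_scope.

(* Formal power series in hbar, given by their coefficients. *)
Record fps (K : Type) : Type := FPS { fps_coef : nat -> K }.

HB.instance Definition _ (K : Type) := gen_eqMixin (fps K).
HB.instance Definition _ (K : Type) := gen_choiceMixin (fps K).

Lemma fpsP (K : Type) (f g : fps K) :
  (forall m, fps_coef f m = fps_coef g m) -> f = g.
Proof. by case: f g => [f] [g] /= fg; congr FPS; apply/funext. Qed.

Section FpsRing.
Variable K : comNzRingType.
Implicit Types f g h : fps K.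

Definition fpsC (c : K) : fps K := FPS (fun m => if m == 0%N then c else 0).
Definition fps_add f g : fps K := FPS (fun m => fps_coef f m + fps_coef g m).
Definition fps_opp f : fps K := FPS (fun m => - fps_coef f m).
Definition fps_mul f g : fps K :=
  FPS (fun m => \sum_(i < m.+1) fps_coef f i * fps_coef g (m - i)%N).

Fact fps_addA : associative fps_add.
Proof. by move=> f g h; apply: fpsP => m /=; rewrite addrA. Qed.
Fact fps_addC : commutative fps_add.
Proof. by move=> f g; apply: fpsP => m /=; rewrite addrC. Qed.
Fact fps_add0 : left_id (fpsC 0) fps_add.
Proof. by move=> f; apply: fpsP => m /=; rewrite if_same add0r. Qed.
Fact fps_addN : left_inverse (fpsC 0) fps_opp fps_add.
Proof. by move=> f; apply: fpsP => m /=; rewrite if_same addNr. Qed.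

HB.instance Definition _ :=
  GRing.isZmodule.Build (fps K) fps_addA fps_addC fps_add0 fps_addN.

Let trunc N f : {poly K} := \poly_(i < N) fps_coef f i.

Let trunc_mul N m f g : (m < N)%N ->
  fps_coef (fps_mul f g) m = (trunc N f * trunc N g)`_m.
Proof.
move=> ltmN; rewrite coefM /=; apply: eq_bigr => i _.
rewrite !coef_poly (leq_ltn_trans _ ltmN) ?leq_ord //.
by rewrite (leq_ltn_trans _ ltmN) // leq_subr.
Qed.

Fact fps_mulA : associative fps_mul.
Proof.
move=> f g h; apply: fpsP => m.
have low a b : forall i : 'I_m.+1,
    fps_coef (fps_mul a b) i = (trunc m.+1 a * trunc m.+1 b)`_i.
  by move=> i; apply: trunc_mul.
transitivity ((trunc m.+1 f * (trunc m.+1 g * trunc m.+1 h))`_m).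
  rewrite coefM /=; apply: eq_bigr => i _; rewrite -trunc_mul ?ltnS ?leq_subr //.
  by rewrite coef_poly ltn_ord.
rewrite mulrA coefM /=; apply: eq_bigr => i _; rewrite -low.
by rewrite coef_poly ltnS leq_subr.
Qed.
Fact fps_mulC : commutative fps_mul.
Proof.
move=> f g; apply: fpsP => m.
by rewrite !(@trunc_mul m.+1) // mulrC.
Qed.
Fact fps_mul1 : left_id (fpsC 1) fps_mul.
Proof.
move=> f; apply: fpsP => m /=; rewrite big_ord_recl /= mul1r subn0.
by rewrite big1 ?addr0 // => i _; rewrite mul0r.
Qed.
Fact fps_mulDl : left_distributive fps_mul fps_add.
Proof.
move=> f g h; apply: fpsP => m /=; rewrite -big_split /=.
by apply: eq_bigr => i _; rewrite mulrDl.
Qed.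
Fact fps_one_neq0 : fpsC 1 != 0.
Proof.
by apply/eqP => /(congr1 (fun f => fps_coef f 0%N)) /= /eqP; rewrite oner_eq0.
Qed.

HB.instance Definition _ :=
  GRing.Zmodule_isComNzRing.Build (fps K)
    fps_mulA fps_mulC fps_mul1 fps_mulDl fps_one_neq0.

Definition fps_unit : {pred fps K} := fun f => `[< exists g, g * f = 1 >].
Definition fps_inv f : fps K := xget f [set g | g * f = 1].

Fact fps_mulV : {in fps_unit, left_inverse 1 fps_inv *%R}.
Proof. by move=> f /asboolP[g gf1]; rewrite /fps_inv; case: xgetP => [h _|/(_ g)]. Qed.
Fact fps_unitP f g : g * f = 1 -> f \in fps_unit.
Proof. by move=> gf1; apply/asboolP; exists g. Qed.
Fact fps_inv_out : {in [predC fps_unit], fps_inv =1 id}.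
Proof.
move=> f /asboolP nu; rewrite /fps_inv; case: xgetP => // g _ /= gf1.
by case: nu; exists g.
Qed.

HB.instance Definition _ :=
  GRing.ComNzRing_hasMulInverse.Build (fps K) fps_mulV fps_unitP fps_inv_out.

End FpsRing.

Section Roots.
Variables (R : realType) (n : nat).
Local Notation C := R[i].

(* Coordinates are numbered from 0; [e k] is only used for k < n. *)
Definition e (k : nat) : 'rV[C]_n := \row_(j < n) (nat_of_ord j == k)%:R.

Definition dot (u v : 'rV[C]_n) : C := \sum_(j < n) u 0 j * v 0 j.

(* The set Gamma of simple roots is indexed by 'I_n.-1. *)
Definition simple_root (k : 'I_n.-1) : 'rV[C]_n := e k - e k.+1.

(* The pair (i, j) stands for the positive root e_i - e_j. *)
Definition posroot := {ij : 'I_n * 'I_n | (ij.1 < ij.2)%N}.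

Definition src (a : posroot) : 'I_n := (val a).1.
Definition tgt (a : posroot) : 'I_n := (val a).2.
Definition root_vec (a : posroot) : 'rV[C]_n := e (src a) - e (tgt a).
Definition height (a : posroot) : nat := (tgt a - src a)%N.

Definition lessdot (a b : posroot) : bool := tgt a == src b.

Definition tilde (Y : {set 'I_n.-1}) : {set posroot} :=
  [set a | root_vec a \in <<[seq simple_root k | k <- enum Y]>>%VS].

(* [tau] is a total function on simple roots; its values outside [Gamma1] are
   irrelevant: in [bd_nilp], the first iterate lying outside [Gamma1] only
   involves values of [tau] on [Gamma1], and all later definitions evaluate
   [tau] on [Gamma1] only. *)
Record bd_triple := BDTriple {
  Gamma1 : {set 'I_n.-1};
  Gamma2 : {set 'I_n.-1};
  tau : 'I_n.-1 -> 'I_n.-1;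
  bd_inj : {in Gamma1 &, injective tau};
  bd_image : tau @: Gamma1 = Gamma2;
  bd_isom : {in Gamma1 &, forall k l,
    dot (simple_root (tau k)) (simple_root (tau l)) =
    dot (simple_root k) (simple_root l)};
  bd_nilp : {in Gamma1, forall k, exists p : nat, iter p tau k \notin Gamma1} }.

Definition bd_orthogonal (X Y : {set 'I_n.-1}) : Prop :=
  {in X & Y, forall k l, dot (simple_root k) (simple_root l) = 0}.

Definition bd_union (I : finType) (T : bd_triple) (F : I -> bd_triple) : Prop :=
  [/\ Gamma1 T = (\bigcup_i Gamma1 (F i))%SET,
      Gamma2 T = (\bigcup_i Gamma2 (F i))%SET
    & forall i, {in Gamma1 (F i), tau T =1 tau (F i)}].

Definition bd_orthogonal_union (I : finType) (T : bd_triple)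
    (F : I -> bd_triple) : Prop :=
  bd_union T F /\
  forall i j, i != j -> bd_orthogonal (Gamma1 (F i)) (Gamma1 (F j)) /\
                        bd_orthogonal (Gamma2 (F i)) (Gamma2 (F j)).

Definition bd_tau_orthogonal_union (I : finType) (T : bd_triple)
    (F : I -> bd_triple) : Prop :=
  bd_orthogonal_union T F /\
  forall i, Gamma2 (F i) :&: Gamma1 T \subset Gamma1 (F i).

Section Triple.
Variable T : bd_triple.

(* The additive extension of tau, as e_i - e_j is the sum of the simple roots
   alpha_k for i <= k < j. *)
Definition tau_vec (a : posroot) : 'rV[C]_n :=
  \sum_(k < n.-1 | (src a <= k < tgt a)%N) simple_root (tau T k).

Definition tau_step (a b : posroot) : bool :=
  (a \in tilde (Gamma1 T)) && (root_vec b == tau_vec a).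

(* [tau_pow p a b] : tau^p is defined at a, with value b. *)
Fixpoint tau_pow (p : nat) (a b : posroot) : bool :=
  if p is p'.+1 then [exists c, tau_step a c && tau_pow p' c b] else a == b.

Definition prec (a b : posroot) : bool :=
  `[< exists p, (0 < p)%N /\ tau_pow p a b >].

(* Below, alpha_k is the first simple root of a; alpha_l is the last simple
   root of b for [prec_left], and the first one for [prec_right]. *)
Definition prec_left (a b : posroot) : bool :=
  `[< exists (p : nat) (k l : 'I_n.-1),
        [/\ (0 < p)%N, tau_pow p a b & (2 <= height a)%N] /\
        [/\ nat_of_ord k = src a, l.+1 = tgt b & iter p (tau T) k = l] >].

Definition prec_right (a b : posroot) : bool :=
  `[< exists (p : nat) (k l : 'I_n.-1),
        [/\ (0 < p)%N, tau_pow p a b & (2 <= height a)%N] /\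
        [/\ nat_of_ord k = src a, nat_of_ord l = src b
          & iter p (tau T) k = l] >].

(* Only used for a prec b, where the three cases are exhaustive. *)
Definition sign (a b : posroot) : C :=
  if prec_left a b then (-1) ^ (1 - (height a)%:Z)
  else if prec_right a b || (height a == 1)%N then 1
  else 0.

Definition iverson (P : Prop) : C := (`[< P >])%:R.

Definition Kexp (a b : posroot) : C :=
  2^-1 * iverson (lessdot a b) - 2^-1 * iverson (lessdot b a)
  + iverson (exists c, [/\ prec a c, prec c b & lessdot a c])
  - iverson (exists c, [/\ prec a c, prec c b & lessdot c a])
  + iverson (prec_left a b) * (1 - (height a)%:R).

(* 0 by default, when no power is defined, i.e. when Gamma1 is empty. *)
Definition tau_depth : nat :=
  let defined p := exists a b, a \in tilde (Gamma1 T) /\ tau_pow p a b in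
  xget 0%N [set d | defined d /\ forall p, defined p -> (p <= d)%N].

End Triple.
End Roots.

Section Tensor.
Variables (K : pzRingType) (n : nat).

(* [tens i j k l] is e_ij (x) e_kl. *)
Definition tens (i j k l : 'I_n) : 'M[K]_(n * n) :=
  delta_mx i j *t delta_mx k l.

(* The coefficient of [tens i j k l] in z. *)
Definition tcoef (z : 'M[K]_(n * n)) (i j k l : 'I_n) : K :=
  z (mxtens_index (i, k)) (mxtens_index (j, l)).

Definition wedge (x y : 'M[K]_n) : 'M[K]_(n * n) := x *t y - y *t x.

Definition flip (z : 'M[K]_(n * n)) : 'M[K]_(n * n) :=
  \sum_i \sum_j \sum_k \sum_l tcoef z i j k l *: tens k l i j.

Definition Pmx : 'M[K]_(n * n) := \sum_i \sum_j tens i j j i.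
Definition P0mx : 'M[K]_(n * n) := \sum_i tens i i i i.

Definition leg12 (z : 'M[K]_(n * n)) : 'M[K]_(n * n * n) :=
  \sum_i \sum_j \sum_k \sum_l
    tcoef z i j k l *: (delta_mx i j *t delta_mx k l *t 1%:M).
Definition leg13 (z : 'M[K]_(n * n)) : 'M[K]_(n * n * n) :=
  \sum_i \sum_j \sum_k \sum_l
    tcoef z i j k l *: (delta_mx i j *t 1%:M *t delta_mx k l).
Definition leg23 (z : 'M[K]_(n * n)) : 'M[K]_(n * n * n) :=
  \sum_i \sum_j \sum_k \sum_l
    tcoef z i j k l *: (1%:M *t delta_mx i j *t delta_mx k l).

Definition QYBE (z : 'M[K]_(n * n)) : Prop :=
  leg12 z *m leg13 z *m leg23 z = leg23 z *m leg13 z *m leg12 z.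

End Tensor.

Section RMatrices.
Variables (R : realType) (n : nat).
Local Notation C := R[i].
Local Notation A := (fps C).

(* q^x = exp (hbar x), for x a scalar and for x in Mat_n (x) Mat_n. *)
Definition qpow (x : C) : A := FPS (fun m => x ^+ m / (m`!)%:R).
Definition qpow_mx (x : 'M[C]_(n * n)) : 'M[A]_(n * n) :=
  \matrix_(u, v) FPS (fun m => (x ^+ m) u v / (m`!)%:R).

Definition q : A := qpow 1.
Definition qV : A := qpow (-1).

Definition Hecke (z : 'M[A]_(n * n)) : Prop :=
  (Pmx A n *m z - q%:M) *m (Pmx A n *m z + qV%:M) = 0.

Definition in_wedge_h (r0 : 'M[C]_(n * n)) : Prop :=
  exists (m : nat) (x y : 'I_m -> 'rV[C]_n),
    r0 = \sum_(k < m) wedge (diag_mx (x k)) (diag_mx (y k)).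

(* [contract f z] is (f (x) 1) z for z in h (x) Mat_n, the row vector f being
   seen as a linear form on h through e_i(e_jj) = delta_ij. *)
Definition contract (f : 'rV[C]_n) (z : 'M[C]_(n * n)) : 'M[C]_n :=
  \matrix_(k, l) \sum_i f 0 i * tcoef z i i k l.

Section Triple.
Variable T : bd_triple R n.

Definition r0_solution (r0 : 'M[C]_(n * n)) : Prop :=
  in_wedge_h r0 /\
  {in Gamma1 T, forall k,
    contract (simple_root R k - simple_root R (tau T k)) r0 =
    2^-1 *: contract (simple_root R k + simple_root R (tau T k)) (P0mx C n)}.

Definition a_ggs : 'M[C]_(n * n) :=
  \sum_a \sum_(b | prec T a b)
    sign T a b *: wedge (delta_mx (tgt a) (src a)) (delta_mx (src b) (tgt b)).

Definition r_s : 'M[C]_(n * n) :=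
  2^-1 *: P0mx C n + \sum_(a : posroot n) tens C (tgt a) (src a) (src a) (tgt a).

Definition eps_ggs : 'M[C]_(n * n) :=
  a_ggs *m r_s + r_s *m a_ggs + a_ggs *m a_ggs.

Definition R_s : 'M[A]_(n * n) :=
  q *: (\sum_i tens A i i i i)
  + \sum_(i < n) \sum_(j < n | i != j) tens A i i j j
  + (q - qV) *: (\sum_(i < n) \sum_(j < n | (j < i)%N) tens A i j j i).

Definition a_tilde : 'M[A]_(n * n) :=
  \matrix_(u, v) (fpsC (a_ggs u v) * qpow (a_ggs u v * eps_ggs u v)).

Definition Rbar_GGS : 'M[A]_(n * n) := R_s + (q - qV) *: a_tilde.

Definition R_GGS (r0 : 'M[C]_(n * n)) : 'M[A]_(n * n) :=
  qpow_mx r0 *m Rbar_GGS *m qpow_mx r0.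

Definition A_pow (p : nat) : 'M[A]_(n * n) :=
  (q - qV) *: \sum_a \sum_(b | tau_pow T p a b)
    (fpsC (sign T a b) * qpow (Kexp T a b))
      *: tens A (src b) (tgt b) (tgt a) (src a).

Definition J_pow (p : nat) : 'M[A]_(n * n) := 1%:M + A_pow p.

Definition J_twist : 'M[A]_(n * n) :=
  \prod_(1 <= p < (tau_depth T).+1) J_pow p.

Definition Rbar_J : 'M[A]_(n * n) := invmx J_twist *m R_s *m flip J_twist.

Definition R_J (r0 : 'M[C]_(n * n)) : 'M[A]_(n * n) :=
  qpow_mx r0 *m Rbar_J *m qpow_mx r0.

Definition GGS_conjecture : Prop :=
  forall r0, r0_solution r0 -> QYBE (R_GGS r0) /\ Hecke (R_GGS r0).

Definition twist_conjecture : Prop :=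
  forall r0, r0_solution r0 -> QYBE (R_J r0) /\ R_J r0 = R_GGS r0.

End Triple.
End RMatrices.

(* Main.v *)
(* Write Rbar_GGS(T) = R_s + C(T).  The matrix units in the legs of C(F i) are
   e_(-alpha) with alpha in the span of Gamma1(F i) and e_beta with beta in the
   span of Gamma2(F i); tau-orthogonality implies that two such units, one
   for i and one for j <> i, have product 0.  Since any two of the leg pairs 12,
   13, 23 share a leg, and the third factor does not act on the shared leg, all
   mixed terms of the QYBE, of the Hecke relation and of J^-1 R_s J_21 vanish:
   C(T) = sum_i C(F i), and the defects of the equations for T are the sums of
   the defects for the F i, the defect of R_s being 0.

   Conversely, the roots alpha - tau(alpha) are linearly independent because tau
   is nilpotent, so for each i some linear form vanishes on them for alpha in
   Gamma1(F i) and equals 1 on them for the other alpha in Gamma1(T).  For the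
   grading it induces, the data of T have nonnegative degree, and their degree 0
   parts are the data of F i; taking degree 0 parts is multiplicative.

   The conjectures quantify over r0: the system for T is solvable, its solutions
   also solve the system for F i, and two solutions for F i differ by a Cartan
   twist, which preserves the QYBE and the Hecke relation. *)

Require Import Defs.
From mathcomp Require Import all_boot all_order all_algebra.
From mathcomp Require Import boolp reals.
From mathcomp Require Import complex mxtens ring.

Set Implicit Arguments.
Unset Strict Implicit.
Unset Printing Implicit Defensive.

Import Order.TTheory GRing.Theory Num.Theory.
Local Open Scope ring_scope.

(** A vanishing sum of defects does not make each summand vanish, so additivity alone cannot give
    the converse; hence the gradings. All linear forms come from one construction: a cost on simple
    roots is summed along the tau-orbit until it leaves Gamma1. Cost 1 everywhere shows that J is
    unipotent, so that its inverse is a finite geometric series; the indicator of the complement of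
    one piece singles out that piece; the indicators of single roots give the dual family from which
    r0 is written down. The values are natural numbers, so degrees are compared through inequalities
    between weights of indices. The additivity of C(T) is not formal, because the coefficients of
    [a_tilde] depend exponentially on those of a and epsilon. At a position where one piece
    contributes to a, the other pieces must contribute neither to a nor to epsilon, and this again
    follows from the gradings. Solvability for r0 keeps the conjectures for T from being vacuous.
    Equality of R_J and R_GGS does not depend on r0, as q^r0 is invertible; only the QYBE and the
    Hecke relation have to be moved between solutions. *)

Local Notation ix2 a b := (mxtens_index (a, b)).
Local Notation ix3 a b c := (mxtens_index (mxtens_index (a, b), c)).

(** * Entries of matrices on tensor squares and cubes *)

Section Entries.
Variables (K : pzRingType) (m n : nat).
Implicit Types A B : 'M[K]_(m, n).
Lemma mxDE A B x y : (A + B) x y = A x y + B x y. Proof. by rewrite mxE. Qed.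
Lemma mxNE A x y : (- A) x y = - A x y. Proof. by rewrite mxE. Qed.
Lemma mxZE (k : K) A x y : (k *: A) x y = k * A x y. Proof. by rewrite mxE. Qed.
End Entries.

Section TensorEntries.
Variables (K : pzRingType) (n : nat).
Implicit Types z w v : 'M[K]_(n * n).

Lemma ix2_eq m p (a c : 'I_m) (b d : 'I_p) :
  (ix2 a b == ix2 c d) = (a == c) && (b == d).
Proof. by rewrite (can_eq (@mxtens_indexK _ _)). Qed.

Lemma big_mxtens (V : nmodType) m p (F : 'I_(m * p) -> V) :
  \sum_x F x = \sum_a \sum_b F (ix2 a b).
Proof.
rewrite pair_big /= (reindex (@mxtens_index m p)) /=.
  by apply: eq_bigr => -[a b].
by exists (@mxtens_unindex m p) => x _; rewrite (mxtens_indexK, mxtens_unindexK).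
Qed.

Lemma mx2P z w :
  (forall a b c d, z (ix2 a b) (ix2 c d) = w (ix2 a b) (ix2 c d)) -> z = w.
Proof.
move=> zw; apply/matrixP => x y.
by case: (mxtens_indexP x) => a b; case: (mxtens_indexP y) => c d.
Qed.

Lemma tensE (i j k l a b c d : 'I_n) :
  tens K i j k l (ix2 a b) (ix2 c d) =
  ([&& a == i, c == j, b == k & d == l])%:R.
Proof. by rewrite tensmxE !mxE -natrM mulnb -!andbA. Qed.

Lemma sum_tens_delta (F : 'I_n -> 'I_n -> 'I_n -> 'I_n -> K) (a a' b b' : 'I_n) :
  \sum_i \sum_j \sum_k \sum_l
     F i j k l * ([&& a == i, a' == j, b == k & b' == l])%:R = F a a' b b'.
Proof.
rewrite (bigD1 a) //= [X in _ + X]big1 ?addr0 => [|i /negPf ia]; last first.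
  do 3 (rewrite big1 // => ? _); by rewrite eq_sym ia /= mulr0.
rewrite (bigD1 a') //= [X in _ + X]big1 ?addr0 => [|i /negPf ia]; last first.
  do 2 (rewrite big1 // => ? _); by rewrite eqxx eq_sym ia /= mulr0.
rewrite (bigD1 b) //= [X in _ + X]big1 ?addr0 => [|i /negPf ia]; last first.
  do 1 (rewrite big1 // => ? _); by rewrite !eqxx eq_sym ia /= mulr0.
rewrite (bigD1 b') //= [X in _ + X]big1 ?addr0 => [|i /negPf ia]; last first.
  by rewrite !eqxx eq_sym ia /= mulr0.
by rewrite !eqxx mulr1.
Qed.

Lemma flipE z (a b c d : 'I_n) :
  flip z (ix2 a b) (ix2 c d) = z (ix2 b a) (ix2 d c).
Proof.
rewrite /flip summxE -[RHS](sum_tens_delta (fun i j k l => z (ix2 i k) (ix2 j l))).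
apply: eq_bigr => i _; rewrite summxE; apply: eq_bigr => j _.
rewrite summxE; apply: eq_bigr => k _; rewrite summxE; apply: eq_bigr => l _.
rewrite mxE tensE /tcoef; congr (_ * (nat_of_bool _)%:R).
by rewrite andbC -!andbA; do !bool_congr.
Qed.

Let leg_sum z (M : 'I_n -> 'I_n -> 'I_n -> 'I_n -> 'M[K]_(n * n * n)) x y :
  (\sum_i \sum_j \sum_k \sum_l tcoef z i j k l *: M i j k l) x y
  = \sum_i \sum_j \sum_k \sum_l tcoef z i j k l * M i j k l x y.
Proof.
rewrite summxE; apply: eq_bigr => i _; rewrite summxE; apply: eq_bigr => j _.
rewrite summxE; apply: eq_bigr => k _; rewrite summxE; apply: eq_bigr => l _.
by rewrite mxE.
Qed.

Lemma leg12E z (a b c a' b' c' : 'I_n) :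
  leg12 z (ix3 a b c) (ix3 a' b' c') = z (ix2 a b) (ix2 a' b') * (c == c')%:R.
Proof.
rewrite /leg12 leg_sum.
rewrite -[RHS](sum_tens_delta
  (fun i j k l => z (ix2 i k) (ix2 j l) * (c == c')%:R)).
do 4 (apply: eq_bigr => ? _); rewrite !tensmxE !mxE /tcoef -[RHS]mulrA; congr (_ * _).
rewrite -!natrM !mulnb; congr (nat_of_bool _)%:R.
by rewrite -!andbA; do ![bool_congr | rewrite [RHS]andbC -!andbA].
Qed.

Lemma leg13E z (a b c a' b' c' : 'I_n) :
  leg13 z (ix3 a b c) (ix3 a' b' c') = z (ix2 a c) (ix2 a' c') * (b == b')%:R.
Proof.
rewrite /leg13 leg_sum.
rewrite -[RHS](sum_tens_delta
  (fun i j k l => z (ix2 i k) (ix2 j l) * (b == b')%:R)).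
do 4 (apply: eq_bigr => ? _); rewrite !tensmxE !mxE /tcoef -[RHS]mulrA; congr (_ * _).
rewrite -!natrM !mulnb; congr (nat_of_bool _)%:R.
by rewrite -!andbA; do ![bool_congr | rewrite [RHS]andbC -!andbA].
Qed.

Lemma leg23E z (a b c a' b' c' : 'I_n) :
  leg23 z (ix3 a b c) (ix3 a' b' c') = z (ix2 b c) (ix2 b' c') * (a == a')%:R.
Proof.
rewrite /leg23 leg_sum.
rewrite -[RHS](sum_tens_delta
  (fun i j k l => z (ix2 i k) (ix2 j l) * (a == a')%:R)).
do 4 (apply: eq_bigr => ? _); rewrite !tensmxE !mxE /tcoef -[RHS]mulrA; congr (_ * _).
rewrite -!natrM !mulnb; congr (nat_of_bool _)%:R.
by rewrite -!andbA; do ![bool_congr | rewrite [RHS]andbC -!andbA].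
Qed.

Lemma PmxE (a b c d : 'I_n) :
  Pmx K n (ix2 a b) (ix2 c d) = ((a == d) && (b == c))%:R.
Proof.
rewrite /Pmx summxE (bigD1 a) //= [X in _ + X]big1 ?addr0 => [|i /negPf ia]; last first.
  by rewrite summxE big1 // => j _; rewrite tensE eq_sym ia.
rewrite summxE (bigD1 c) //= [X in _ + X]big1 ?addr0 => [|i /negPf ia]; last first.
  by rewrite tensE [c == i]eq_sym ia andbF.
by rewrite tensE !eqxx /= andbC [d == a]eq_sym.
Qed.

Lemma mul_PmxE z (a b : 'I_n) y : (Pmx K n *m z) (ix2 a b) y = z (ix2 b a) y.
Proof.
rewrite mxE big_mxtens (bigD1 b) //= [X in _ + X]big1 ?addr0 => [|i /negPf ib]; last first.
  by rewrite big1 // => j _; rewrite PmxE [b == i]eq_sym ib andbF mul0r.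
rewrite (bigD1 a) //= [X in _ + X]big1 ?addr0 => [|i /negPf ib]; last first.
  by rewrite PmxE eq_sym ib mul0r.
by rewrite PmxE !eqxx mul1r.
Qed.

Lemma P0mxE (a b c d : 'I_n) :
  P0mx K n (ix2 a b) (ix2 c d) = [&& a == b, a == c & a == d]%:R.
Proof.
rewrite /P0mx summxE (bigD1 a) //= [X in _ + X]big1 ?addr0 => [|i /negPf ia]; last first.
  by rewrite tensE eq_sym ia.
rewrite tensE eqxx [b == a]eq_sym [c == a]eq_sym [d == a]eq_sym.
by congr (nat_of_bool _)%:R; do !bool_congr.
Qed.

End TensorEntries.

(** * Gradings of matrices by weights of indices, and degree 0 parts *)

Section GradedMatrices.
Variable K : pzRingType.

(** A weight [h] gives the matrix unit at (x, y) the degree [h y - h x]; the condition excludes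
    negative degrees without using subtraction in nat. *)
Definition nneg N (h : 'I_N -> nat) (M : 'M[K]_N) : Prop :=
  forall x y, M x y != 0 -> (h x <= h y)%N.

Definition deg0 N (h : 'I_N -> nat) (M : 'M[K]_N) : 'M[K]_N :=
  \matrix_(x, y) if h x == h y then M x y else 0.

Section OneGrading.
Variables (N : nat) (h : 'I_N -> nat).
Implicit Types A B : 'M[K]_N.

Lemma nneg0 : nneg h 0.
Proof. by move=> x y; rewrite mxE eqxx. Qed.

Lemma nneg_scalar (a : K) : nneg h a%:M.
Proof. by move=> x y; rewrite mxE; case: (x =P y) => [->|] //; rewrite mulr0n eqxx. Qed.

Lemma nnegD A B : nneg h A -> nneg h B -> nneg h (A + B).
Proof.
move=> nA nB x y; rewrite mxE; have [A0|/nA //] := eqVneq (A x y) 0.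
by rewrite A0 add0r => /nB.
Qed.

Lemma nnegN A : nneg h A -> nneg h (- A).
Proof. by move=> nA x y; rewrite mxE oppr_eq0 => /nA. Qed.

Lemma nnegZ (a : K) A : nneg h A -> nneg h (a *: A).
Proof.
move=> nA x y; rewrite mxE; have [A0|/nA //] := eqVneq (A x y) 0.
by rewrite A0 mulr0 eqxx.
Qed.

Lemma nneg_sum (J : Type) (r : seq J) (P : pred J) (F : J -> 'M[K]_N) :
  (forall j, P j -> nneg h (F j)) -> nneg h (\sum_(j <- r | P j) F j).
Proof. by move=> nF; apply: big_ind => //; [apply: nneg0 | apply: nnegD]. Qed.

Lemma nnegM A B : nneg h A -> nneg h B -> nneg h (A *m B).
Proof.
move=> nA nB x y; rewrite mxE; apply: contraR => lexy.
rewrite big1 // => k _; have [->|/nA xk] := eqVneq (A x k) 0; first by rewrite mul0r.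
have [->|/nB ky] := eqVneq (B k y) 0; first by rewrite mulr0.
by rewrite (leq_trans xk ky) in lexy.
Qed.

Lemma deg0D A B : deg0 h (A + B) = deg0 h A + deg0 h B.
Proof. by apply/matrixP => x y; rewrite !mxE; case: eqP; rewrite ?addr0. Qed.

Lemma deg0N A : deg0 h (- A) = - deg0 h A.
Proof. by apply/matrixP => x y; rewrite !mxE; case: eqP; rewrite ?oppr0. Qed.

Lemma deg0_0 : deg0 h 0 = 0.
Proof. by apply/matrixP => x y; rewrite !mxE if_same. Qed.

Lemma deg0_scalar (a : K) : deg0 h a%:M = a%:M.
Proof.
apply/matrixP => x y; rewrite !mxE; case: (x =P y) => [->|]; first by rewrite eqxx.
by rewrite mulr0n if_same.
Qed.

Lemma deg0_sum (J : Type) (r : seq J) (P : pred J) (F : J -> 'M[K]_N) :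
  deg0 h (\sum_(j <- r | P j) F j) = \sum_(j <- r | P j) deg0 h (F j).
Proof. by apply: (big_morph _ deg0D deg0_0). Qed.

(** For entries at (x, k) and (k, y) with [h x = h y], the inequalities [h x <= h k <= h y] force
    equality. Without nonnegativity, factors of opposite degrees would also contribute. *)
Lemma deg0M A B : nneg h A -> nneg h B ->
  deg0 h (A *m B) = deg0 h A *m deg0 h B.
Proof.
move=> nA nB; apply/matrixP => x y; rewrite !mxE.
have [xy|xy] := eqVneq (h x) (h y).
  apply: eq_bigr => k _; rewrite !mxE -xy eq_sym.
  have [//|nxk] := eqVneq (h k) (h x).
  have [->|/nA xk] := eqVneq (A x k) 0; first by rewrite !mul0r.
  have [->|/nB ky] := eqVneq (B k y) 0; first by rewrite !mulr0.
  by move: nxk; rewrite eqn_leq xk xy ky.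
rewrite big1 // => k _; rewrite !mxE.
have [xk|] := eqVneq (h x) (h k); last by rewrite mul0r.
have [ky|] := eqVneq (h k) (h y); last by rewrite mulr0.
by rewrite xk ky eqxx in xy.
Qed.

End OneGrading.

Definition wt2 n (h : 'I_n -> nat) (x : 'I_(n * n)) : nat :=
  (h (mxtens_unindex x).1 + h (mxtens_unindex x).2)%N.

Definition wt3 n (h : 'I_n -> nat) (x : 'I_(n * n * n)) : nat :=
  (wt2 h (mxtens_unindex x).1 + h (mxtens_unindex x).2)%N.

Variables (n : nat) (h : 'I_n -> nat).
Implicit Types z : 'M[K]_(n * n).

Lemma wt2E a b : wt2 h (ix2 a b) = (h a + h b)%N.
Proof. by rewrite /wt2 mxtens_indexK. Qed.

Lemma wt3E a b c : wt3 h (ix3 a b c) = (h a + h b + h c)%N.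
Proof. by rewrite /wt3 mxtens_indexK /= wt2E. Qed.

Lemma mx3P (A B : 'M[K]_(n * n * n)) :
  (forall a b c a' b' c', A (ix3 a b c) (ix3 a' b' c') = B (ix3 a b c) (ix3 a' b' c')) ->
  A = B.
Proof.
move=> AB; apply/matrixP => x y.
case: (mxtens_indexP x) => x' c; case: (mxtens_indexP x') => a b.
by case: (mxtens_indexP y) => y' c'; case: (mxtens_indexP y') => a' b'.
Qed.

Lemma nneg_wt2P z :
  (forall a b c d, z (ix2 a b) (ix2 c d) != 0 -> (h a + h b <= h c + h d)%N) ->
  nneg (wt2 h) z.
Proof.
move=> nz x y; case: (mxtens_indexP x) => a b; case: (mxtens_indexP y) => c d.
by rewrite !wt2E; apply: nz.
Qed.

Let nneg_wt3P (A : 'M[K]_(n * n * n)) :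
  (forall a b c a' b' c', A (ix3 a b c) (ix3 a' b' c') != 0 ->
     (h a + h b + h c <= h a' + h b' + h c')%N) ->
  nneg (wt3 h) A.
Proof.
move=> nA x y.
case: (mxtens_indexP x) => x' c; case: (mxtens_indexP x') => a b.
case: (mxtens_indexP y) => y' c'; case: (mxtens_indexP y') => a' b'.
by rewrite !wt3E; apply: nA.
Qed.

Lemma nneg_leg12 z : nneg (wt2 h) z -> nneg (wt3 h) (leg12 z).
Proof.
move=> nz; apply: nneg_wt3P => a b c a' b' c'; rewrite leg12E.
have [->|/nz] := eqVneq (z (ix2 a b) (ix2 a' b')) 0; first by rewrite mul0r eqxx.
by rewrite !wt2E; case: (c =P c') => [->|]; rewrite ?mulr0 ?eqxx // leq_add2r.
Qed.

Lemma nneg_leg13 z : nneg (wt2 h) z -> nneg (wt3 h) (leg13 z).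
Proof.
move=> nz; apply: nneg_wt3P => a b c a' b' c'; rewrite leg13E.
have [->|/nz] := eqVneq (z (ix2 a c) (ix2 a' c')) 0; first by rewrite mul0r eqxx.
rewrite !wt2E; case: (b =P b') => [->|]; rewrite ?mulr0 ?eqxx //.
by rewrite ![(_ + h b')%N]addnC -!addnA leq_add2l.
Qed.

Lemma nneg_leg23 z : nneg (wt2 h) z -> nneg (wt3 h) (leg23 z).
Proof.
move=> nz; apply: nneg_wt3P => a b c a' b' c'; rewrite leg23E.
have [->|/nz] := eqVneq (z (ix2 b c) (ix2 b' c')) 0; first by rewrite mul0r eqxx.
rewrite !wt2E; case: (a =P a') => [->|]; rewrite ?mulr0 ?eqxx //.
by rewrite -!addnA leq_add2l.
Qed.

Lemma deg0_leg12 z : deg0 (wt3 h) (leg12 z) = leg12 (deg0 (wt2 h) z).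
Proof.
apply: mx3P => a b c a' b' c'; rewrite mxE !leg12E mxE !wt2E !wt3E.
case: (c =P c') => [->|]; last by rewrite !mulr0 if_same.
by rewrite eqn_add2r !mulr1.
Qed.

Lemma deg0_leg13 z : deg0 (wt3 h) (leg13 z) = leg13 (deg0 (wt2 h) z).
Proof.
apply: mx3P => a b c a' b' c'; rewrite mxE !leg13E mxE !wt2E !wt3E.
case: (b =P b') => [->|]; last by rewrite !mulr0 if_same.
by rewrite ![(_ + h b')%N]addnC -!addnA eqn_add2l !mulr1.
Qed.

Lemma deg0_leg23 z : deg0 (wt3 h) (leg23 z) = leg23 (deg0 (wt2 h) z).
Proof.
apply: mx3P => a b c a' b' c'; rewrite mxE !leg23E mxE !wt2E !wt3E.
case: (a =P a') => [->|]; last by rewrite !mulr0 if_same.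
by rewrite -!addnA eqn_add2l !mulr1.
Qed.

Lemma QYBE_deg0 z : nneg (wt2 h) z -> QYBE z -> QYBE (deg0 (wt2 h) z).
Proof.
move=> nz; rewrite /QYBE -deg0_leg12 -deg0_leg13 -deg0_leg23.
have n12 := nneg_leg12 nz; have n13 := nneg_leg13 nz; have n23 := nneg_leg23 nz.
by rewrite -!deg0M // => [->||]; try exact: nnegM.
Qed.

Lemma nneg_Pmx : nneg (wt2 h) (Pmx K n).
Proof.
apply: nneg_wt2P => a b c d; rewrite PmxE.
by case: (a =P d) => [->|] /=; [case: (b =P c) => [->|]|]; rewrite ?eqxx // addnC.
Qed.

Lemma deg0_Pmx : deg0 (wt2 h) (Pmx K n) = Pmx K n.
Proof.
apply: mx2P => a b c d; rewrite mxE PmxE !wt2E.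
case: (a =P d) => [->|] /=; rewrite ?if_same //.
by case: (b =P c) => [->|]; rewrite ?if_same // addnC eqxx.
Qed.

Lemma nneg_flip z : nneg (wt2 h) z -> nneg (wt2 h) (flip z).
Proof.
move=> nz; apply: nneg_wt2P => a b c d; rewrite flipE => /nz.
by rewrite !wt2E addnC [(h d + _)%N]addnC.
Qed.

Lemma deg0_flip z : deg0 (wt2 h) (flip z) = flip (deg0 (wt2 h) z).
Proof.
apply: mx2P => a b c d; rewrite mxE !flipE mxE !wt2E.
by rewrite addnC [(h d + _)%N]addnC.
Qed.

Lemma deg0_Hecke (a b : K) z : nneg (wt2 h) z ->
  deg0 (wt2 h) ((Pmx K n *m z - a%:M) *m (Pmx K n *m z + b%:M)) =
  (Pmx K n *m deg0 (wt2 h) z - a%:M) *m (Pmx K n *m deg0 (wt2 h) z + b%:M).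
Proof.
move=> nz; have nPz := nnegM nneg_Pmx nz.
rewrite deg0M; last by apply: nnegD => //; apply: nneg_scalar.
  by rewrite !deg0D deg0N !deg0_scalar deg0M ?deg0_Pmx //; apply: nneg_Pmx.
by apply: nnegD => //; apply/nnegN/nneg_scalar.
Qed.

End GradedMatrices.

(** * Supports of legs and vanishing of mixed products *)

Section LegSupport.
Variables (K : pzRingType) (n : nat).
Implicit Types (L : 'I_n -> 'I_n -> Prop) (x y z C : 'M[K]_(n * n)).

Lemma mul_leg12E N x (M : 'M[K]_(n * n * n, N)) (a b c : 'I_n) t :
  (leg12 x *m M) (ix3 a b c) t =
  \sum_a1 \sum_b1 x (ix2 a b) (ix2 a1 b1) * M (ix3 a1 b1 c) t.
Proof.
rewrite mxE !big_mxtens; apply: eq_bigr => a1 _; apply: eq_bigr => b1 _.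
rewrite (bigD1 c) //= [X in _ + X]big1 ?addr0 => [|d /negPf dc].
  by rewrite leg12E eqxx mulr1.
by rewrite leg12E eq_sym dc mulr0 mul0r.
Qed.

Lemma mul_leg13E N y (M : 'M[K]_(n * n * n, N)) (a b c : 'I_n) t :
  (leg13 y *m M) (ix3 a b c) t =
  \sum_a1 \sum_c1 y (ix2 a c) (ix2 a1 c1) * M (ix3 a1 b c1) t.
Proof.
rewrite mxE !big_mxtens; apply: eq_bigr => a1 _.
rewrite (bigD1 b) //= [X in _ + X]big1 ?addr0 => [|d /negPf db].
  by apply: eq_bigr => c1 _; rewrite leg13E eqxx mulr1.
by rewrite big1 // => c1 _; rewrite leg13E eq_sym db mulr0 mul0r.
Qed.

Lemma mul_leg23E N z (M : 'M[K]_(n * n * n, N)) (a b c : 'I_n) t :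
  (leg23 z *m M) (ix3 a b c) t =
  \sum_b1 \sum_c1 z (ix2 b c) (ix2 b1 c1) * M (ix3 a b1 c1) t.
Proof.
rewrite mxE !big_mxtens (bigD1 a) //= [X in _ + X]big1 ?addr0 => [|d /negPf da].
  apply: eq_bigr => b1 _; apply: eq_bigr => c1 _.
  by rewrite leg23E eqxx mulr1.
rewrite big1 // => b1 _; rewrite big1 // => c1 _.
by rewrite leg23E eq_sym da mulr0 mul0r.
Qed.

Lemma leg12_13_23E x y z (a b c a2 b2 c2 : 'I_n) :
  (leg12 x *m leg13 y *m leg23 z) (ix3 a b c) (ix3 a2 b2 c2) =
  \sum_a1 \sum_b1 \sum_a' \sum_c1
    x (ix2 a b) (ix2 a1 b1) * y (ix2 a1 c) (ix2 a' c1)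
    * (z (ix2 b1 c1) (ix2 b2 c2) * (a' == a2)%:R).
Proof.
rewrite -mulmxA mul_leg12E; apply: eq_bigr => a1 _; apply: eq_bigr => b1 _.
rewrite mul_leg13E mulr_sumr; apply: eq_bigr => a' _.
by rewrite mulr_sumr; apply: eq_bigr => c1 _; rewrite leg23E mulrA.
Qed.

Lemma leg23_13_12E x y z (a b c a2 b2 c2 : 'I_n) :
  (leg23 z *m leg13 y *m leg12 x) (ix3 a b c) (ix3 a2 b2 c2) =
  \sum_b1 \sum_c1 \sum_a1 \sum_c'
    z (ix2 b c) (ix2 b1 c1) * y (ix2 a c1) (ix2 a1 c')
    * (x (ix2 a1 b1) (ix2 a2 b2) * (c' == c2)%:R).
Proof.
rewrite -mulmxA mul_leg23E; apply: eq_bigr => b1 _; apply: eq_bigr => c1 _.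
rewrite mul_leg13E mulr_sumr; apply: eq_bigr => a1 _.
by rewrite mulr_sumr; apply: eq_bigr => c' _; rewrite leg12E mulrA.
Qed.

(** One relation bounds both legs, because the flip in the Hecke relation and in J_21 lets a leg of
    one factor meet either leg of another. *)
Definition legsupp L z := forall a b c d : 'I_n,
  z (ix2 a b) (ix2 c d) != 0 -> L a c /\ L b d.

Definition leg_excl L L' := forall a b c, L a b -> L' b c -> False.

Definition leg_disjoint C C' := exists L L',
  [/\ legsupp L C, legsupp L' C', leg_excl L L' & leg_excl L' L].

Lemma leg_disjoint0 C : leg_disjoint C 0.
Proof.
exists (fun _ _ => True), (fun _ _ => False); split=> // a b c d.
by rewrite mxE eqxx.
Qed.

Lemma legsuppD L L' C C' : legsupp L C -> legsupp L' C' ->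
  legsupp (fun a b => L a b \/ L' a b) (C + C').
Proof.
move=> sL sL' a b c d; rewrite mxE.
have [->|/sL[? ?] _] := eqVneq (C (ix2 a b) (ix2 c d)) 0; last by split; left.
by rewrite add0r => /sL'[? ?]; split; right.
Qed.

Lemma leg_disjointD C C' C'' :
  leg_disjoint C C' -> leg_disjoint C C'' -> leg_disjoint C (C' + C'').
Proof.
move=> [L1 [L1' [s1 s1' e1 e1']]] [L2 [L2' [s2 s2' e2 e2']]].
exists (fun a b => L1 a b /\ L2 a b), (fun a b => L1' a b \/ L2' a b); split.
- by move=> a b c d nz; have [? ?] := s1 _ _ _ _ nz; have [? ?] := s2 _ _ _ _ nz.
- exact: legsuppD.
- by move=> a b c [l1 l2] [/(e1 _ _ _ l1)|/(e2 _ _ _ l2)].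
- by move=> a b c [l1|l2] [k1 k2]; [apply: e1' l1 k1|apply: e2' l2 k2].
Qed.

Lemma sum4_eq0 (F : 'I_n -> 'I_n -> 'I_n -> 'I_n -> K) :
  (forall a b c d, F a b c d = 0) -> \sum_a \sum_b \sum_c \sum_d F a b c d = 0.
Proof. by move=> F0; do 4 (rewrite big1 // => ? _). Qed.

Definition mul123 x y z := leg12 x *m leg13 y *m leg23 z.
(** The arguments follow the order of the factors, not of the legs, so that [C] standing to the left
    of [C'] means the same for both products. *)
Definition mul321 x y z := leg23 x *m leg13 y *m leg12 z.

Section Vanishing.
Variables (L L' : 'I_n -> 'I_n -> Prop) (C C' : 'M[K]_(n * n)).
Hypotheses (sC : legsupp L C) (sC' : legsupp L' C') (LL' : leg_excl L L').

Lemma mulmx_legs : C *m C' = 0.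
Proof.
apply: mx2P => a b c d; rewrite mxE big_mxtens [RHS]mxE big1 // => a1 _.
rewrite big1 // => b1 _.
have [->|/sC[l1 _]] := eqVneq (C (ix2 a b) (ix2 a1 b1)) 0; first by rewrite mul0r.
have [->|/sC'[l2 _]] := eqVneq (C' (ix2 a1 b1) (ix2 c d)) 0; first by rewrite mulr0.
by case: (LL' l1 l2).
Qed.

(** The shared leg is 1, 3 and 2 respectively; in the last case the middle factor acts on legs 1 and
    3 only, so the two units on leg 2 still meet. *)
Lemma mul123_legs x :
  [/\ mul123 C C' x = 0, mul123 x C C' = 0 & mul123 C x C' = 0].
Proof.
split; apply: mx3P => a b c a2 b2 c2; rewrite leg12_13_23E [RHS]mxE;
  apply: sum4_eq0 => a1 b1 a' c1.
- have [->|/sC[l _]] := eqVneq (C (ix2 a b) (ix2 a1 b1)) 0; first by rewrite !mul0r.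
  have [->|/sC'[l' _]] := eqVneq (C' (ix2 a1 c) (ix2 a' c1)) 0.
    by rewrite mulr0 mul0r.
  by case: (LL' l l').
- have [->|/sC[_ l]] := eqVneq (C (ix2 a1 c) (ix2 a' c1)) 0.
    by rewrite mulr0 mul0r.
  have [->|/sC'[_ l']] := eqVneq (C' (ix2 b1 c1) (ix2 b2 c2)) 0.
    by rewrite mul0r mulr0.
  by case: (LL' l l').
- have [->|/sC[_ l]] := eqVneq (C (ix2 a b) (ix2 a1 b1)) 0; first by rewrite !mul0r.
  have [->|/sC'[l' _]] := eqVneq (C' (ix2 b1 c1) (ix2 b2 c2)) 0.
    by rewrite mul0r mulr0.
  by case: (LL' l l').
Qed.

Lemma mul321_legs x :
  [/\ mul321 C C' x = 0, mul321 x C C' = 0 & mul321 C x C' = 0].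
Proof.
split; apply: mx3P => a b c a2 b2 c2; rewrite leg23_13_12E [RHS]mxE;
  apply: sum4_eq0 => b1 c1 a1 c'.
- have [->|/sC[_ l]] := eqVneq (C (ix2 b c) (ix2 b1 c1)) 0; first by rewrite !mul0r.
  have [->|/sC'[_ l']] := eqVneq (C' (ix2 a c1) (ix2 a1 c')) 0.
    by rewrite mulr0 mul0r.
  by case: (LL' l l').
- have [->|/sC[l _]] := eqVneq (C (ix2 a c1) (ix2 a1 c')) 0.
    by rewrite mulr0 mul0r.
  have [->|/sC'[l' _]] := eqVneq (C' (ix2 a1 b1) (ix2 a2 b2)) 0.
    by rewrite mul0r mulr0.
  by case: (LL' l l').
- have [->|/sC[l _]] := eqVneq (C (ix2 b c) (ix2 b1 c1)) 0; first by rewrite !mul0r.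
  have [->|/sC'[_ l']] := eqVneq (C' (ix2 a1 b1) (ix2 a2 b2)) 0.
    by rewrite mul0r mulr0.
  by case: (LL' l l').
Qed.

End Vanishing.

Lemma leg12D x y : leg12 (x + y) = leg12 x + leg12 y.
Proof. by apply: mx3P => *; rewrite mxE !leg12E mxE mulrDl. Qed.
Lemma leg13D x y : leg13 (x + y) = leg13 x + leg13 y.
Proof. by apply: mx3P => *; rewrite mxE !leg13E mxE mulrDl. Qed.
Lemma leg23D x y : leg23 (x + y) = leg23 x + leg23 y.
Proof. by apply: mx3P => *; rewrite mxE !leg23E mxE mulrDl. Qed.

Lemma mul123D x x' y y' z z' :
  [/\ mul123 (x + x') y z = mul123 x y z + mul123 x' y z,
      mul123 x (y + y') z = mul123 x y z + mul123 x y' z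
    & mul123 x y (z + z') = mul123 x y z + mul123 x y z'].
Proof.
by rewrite /mul123 leg12D leg13D leg23D; split; rewrite ?mulmxDr ?mulmxDl.
Qed.

Lemma mul321D x x' y y' z z' :
  [/\ mul321 (x + x') y z = mul321 x y z + mul321 x' y z,
      mul321 x (y + y') z = mul321 x y z + mul321 x y' z
    & mul321 x y (z + z') = mul321 x y z + mul321 x y z'].
Proof.
by rewrite /mul321 leg12D leg13D leg23D; split; rewrite ?mulmxDr ?mulmxDl.
Qed.

End LegSupport.

(** * Additivity of the QYBE and Hecke defects *)

Lemma trilinear_diagD (V : zmodType) (K : comNzRingType) N
    (f : V -> V -> V -> 'M[K]_N) (r c d : V) :
  (forall x x' y z, f (x + x') y z = f x y z + f x' y z) ->
  (forall x y y' z, f x (y + y') z = f x y z + f x y' z) ->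
  (forall x y z z', f x y (z + z') = f x y z + f x y z') ->
  (forall x, [/\ f c d x = 0, f x c d = 0 & f c x d = 0]) ->
  (forall x, [/\ f d c x = 0, f x d c = 0 & f d x c = 0]) ->
  let g s := f s s s in g (r + (c + d)) = g (r + c) + g (r + d) - g r.
Proof.
move=> f1 f2 f3 fcd fdc /=; rewrite !(f1, f2, f3).
(* As the remaining argument is arbitrary, these identities kill every term of the expansion
   containing both [c] and [d]. The term in [r] alone is then counted twice on the right, whence the
   subtraction. *)
have cd x : f c d x = 0 by case: (fcd x).
have xcd x : f x c d = 0 by case: (fcd x).
have cxd x : f c x d = 0 by case: (fcd x).
have dc x : f d c x = 0 by case: (fdc x).
have xdc x : f x d c = 0 by case: (fdc x).
have dxc x : f d x c = 0 by case: (fdc x).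
rewrite !(cd, xcd, cxd, dc, xdc, dxc) !(addr0, add0r).
by apply/matrixP => x y; rewrite !mxE; ring.
Qed.

Section Defects.
Variables (K : comNzRingType) (n : nat).
Implicit Types r c d z : 'M[K]_(n * n).

Definition qybe_defect z : 'M[K]_(n * n * n) := mul123 z z z - mul321 z z z.

Lemma QYBEP z : QYBE z <-> qybe_defect z = 0.
Proof. by split=> [|/subr0_eq //] zz; apply/eqP; rewrite subr_eq0; apply/eqP. Qed.

Definition hecke_defect (a b : K) z : 'M[K]_(n * n) :=
  (Pmx K n *m z - a%:M) *m (Pmx K n *m z + b%:M).

Lemma qybe_defectD r c d : leg_disjoint c d ->
  qybe_defect (r + (c + d)) =
  qybe_defect (r + c) + qybe_defect (r + d) - qybe_defect r.
Proof.
move=> [L [L' [sc sd e e']]]; rewrite /qybe_defect.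
rewrite (@trilinear_diagD _ _ _ (@mul123 K n)) /=; last 5 first.
- by move=> x x' y z; case: (mul123D x x' y 0 z 0).
- by move=> x y y' z; case: (mul123D x 0 y y' z 0).
- by move=> x y z z'; case: (mul123D x 0 y 0 z z').
- exact: mul123_legs sc sd e.
- exact: mul123_legs sd sc e'.
rewrite (@trilinear_diagD _ _ _ (fun x y z => mul321 x y z)) /=; last 5 first.
- by move=> x x' y z; case: (mul321D x x' y 0 z 0).
- by move=> x y y' z; case: (mul321D x 0 y y' z 0).
- by move=> x y z z'; case: (mul321D x 0 y 0 z z').
- exact: mul321_legs sc sd e.
- exact: mul321_legs sd sc e'.
by apply/matrixP => x y; rewrite !mxE; ring.
Qed.

Lemma mul_Pmx_legs L L' c d : legsupp L c -> legsupp L' d -> leg_excl L L' ->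
  c *m (Pmx K n *m d) = 0.
Proof.
move=> sc sd e; apply: mx2P => a b a2 b2; rewrite mxE big_mxtens [RHS]mxE.
rewrite big1 // => a1 _; rewrite big1 // => b1 _; rewrite mul_PmxE.
have [->|/sc[l _]] := eqVneq (c (ix2 a b) (ix2 a1 b1)) 0; first by rewrite mul0r.
have [->|/sd[_ l']] := eqVneq (d (ix2 b1 a1) (ix2 a2 b2)) 0; first by rewrite mulr0.
by case: (e _ _ _ l l').
Qed.

Lemma hecke_defectD (a b : K) r c d : leg_disjoint c d ->
  hecke_defect a b (r + (c + d)) =
  hecke_defect a b (r + c) + hecke_defect a b (r + d) - hecke_defect a b r.
Proof.
move=> [L [L' [sc sd e e']]]; rewrite /hecke_defect.
set P := Pmx K n; rewrite !(mulmxDr P).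
have: P *m c *m (P *m d) = 0 by rewrite -mulmxA (mul_Pmx_legs sc sd e) mulmx0.
have: P *m d *m (P *m c) = 0 by rewrite -mulmxA (mul_Pmx_legs sd sc e') mulmx0.
move: (P *m r) (P *m c) (P *m d) => u v w wv vw.
rewrite !(mulmxDl, mulmxDr, vw, wv, addr0, add0r).
by apply/matrixP => x y; rewrite !(mxDE, mxNE); ring.
Qed.

(** The map sending [c] to [D c - D 0] is additive on disjoint summands; the induction needs one
    piece to be disjoint from the sum of the remaining ones. *)
Lemma sum_defect (W : zmodType) (D : 'M[K]_(n * n) -> W) (I : finType)
    (C : I -> 'M[K]_(n * n)) :
  (forall c d, leg_disjoint c d -> D (c + d) = D c + D d - D 0) ->
  (forall i j, i != j -> leg_disjoint (C i) (C j)) ->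
  D (\sum_i C i) - D 0 = \sum_i (D (C i) - D 0).
Proof.
move=> DD dC; rewrite -!big_enum /=.
elim: (enum I) (enum_uniq I) => [|i s IHs] /=; first by rewrite !big_nil subrr.
case/andP=> nis us; rewrite !big_cons -IHs // DD.
  by rewrite [RHS]addrACA addrA.
elim: s nis {IHs us} => [_|j s IHs]; first by rewrite big_nil; apply: leg_disjoint0.
rewrite inE negb_or big_cons => /andP[ij nis].
by apply: leg_disjointD; [apply: dC | apply: IHs].
Qed.

Lemma qybe_defect_sum r (I : finType) (C : I -> 'M[K]_(n * n)) :
  (forall i j, i != j -> leg_disjoint (C i) (C j)) ->
  qybe_defect (r + \sum_i C i) - qybe_defect r =
  \sum_i (qybe_defect (r + C i) - qybe_defect r).
Proof.
move=> dC; have := @sum_defect _ (fun c => qybe_defect (r + c)) _ C.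
by rewrite addr0; apply=> // c d; apply: qybe_defectD.
Qed.

Lemma hecke_defect_sum (a b : K) r (I : finType) (C : I -> 'M[K]_(n * n)) :
  (forall i j, i != j -> leg_disjoint (C i) (C j)) ->
  hecke_defect a b (r + \sum_i C i) - hecke_defect a b r =
  \sum_i (hecke_defect a b (r + C i) - hecke_defect a b r).
Proof.
move=> dC; have := @sum_defect _ (fun c => hecke_defect a b (r + c)) _ C.
by rewrite addr0; apply=> // c d; apply: hecke_defectD.
Qed.

Lemma QYBE_sum r (I : finType) (C : I -> 'M[K]_(n * n)) :
  (forall i j, i != j -> leg_disjoint (C i) (C j)) -> qybe_defect r = 0 ->
  (forall i, QYBE (r + C i)) -> QYBE (r + \sum_i C i).
Proof.
move=> dC r0 rC; apply/QYBEP; have := qybe_defect_sum r dC.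
rewrite r0 subr0 => ->; rewrite big1 // => i _; rewrite subr0.
exact/QYBEP.
Qed.

Lemma hecke_sum (a b : K) r (I : finType) (C : I -> 'M[K]_(n * n)) :
  (forall i j, i != j -> leg_disjoint (C i) (C j)) -> hecke_defect a b r = 0 ->
  (forall i, hecke_defect a b (r + C i) = 0) -> hecke_defect a b (r + \sum_i C i) = 0.
Proof.
move=> dC r0 rC; have := hecke_defect_sum a b r dC.
by rewrite r0 subr0 => ->; rewrite big1 // => i _; rewrite rC subr0.
Qed.

End Defects.

(** * Twists by diagonal matrices *)

Section DiagonalTwist.
Variables (K : comNzRingType) (n : nat).
Implicit Types (t : 'I_n -> 'I_n -> K) (z : 'M[K]_(n * n)).

Definition diag2 t : 'M[K]_(n * n) :=
  diag_mx (\row_x t (mxtens_unindex x).1 (mxtens_unindex x).2).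

Lemma diag2E t z (a b c d : 'I_n) :
  (diag2 t *m z *m diag2 t) (ix2 a b) (ix2 c d) =
  t a b * z (ix2 a b) (ix2 c d) * t c d.
Proof. by rewrite mul_mx_diag mxE mul_diag_mx mxE !mxE !mxtens_indexK. Qed.

Lemma diag2M t t' : diag2 t *m diag2 t' = diag2 (fun a b => t a b * t' a b).
Proof.
rewrite mul_diag_mx; apply/matrixP => x y; rewrite !mxE.
by case: eqP => [->|]; rewrite ?mulr0.
Qed.

Lemma legsupp_diag2 L t z : legsupp L z -> legsupp L (diag2 t *m z *m diag2 t).
Proof.
move=> sz a b c d; rewrite diag2E => nz; apply: sz.
by apply: contraNneq nz => ->; rewrite mulr0 mul0r.
Qed.

Lemma nneg_diag2 h t : nneg h (diag2 t).
Proof. by move=> x y; rewrite !mxE; case: (x =P y) => [->|] //; rewrite eqxx. Qed.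

Lemma deg0_diag2 h t : deg0 h (diag2 t) = diag2 t.
Proof.
apply/matrixP => x y; rewrite !mxE; case: (x =P y) => [->|]; rewrite ?eqxx //.
by rewrite mulr0n if_same.
Qed.

Section Exponential.
Variables (F : comNzRingType) (E : F -> K) (s : 'I_n -> 'I_n -> F).
Hypotheses (ED : forall u v, E (u + v) = E u * E v) (E0 : E 0 = 1).
Hypothesis s_anti : forall a b, s b a = - s a b.
Let t a b := E (s a b).

(** A zero weight condition: for each [x], the diagonal matrix with entries [s a x], acting
    additively on both tensor factors, commutes with [z]. *)
Definition weight_compat z := forall a b c d : 'I_n,
  z (ix2 a b) (ix2 c d) != 0 -> forall x, s a x + s b x = s c x + s d x.

Let f a b c := s a b + s a c + s b c.

(** All paths through intermediate indices acquire the same factor: weight compatibility and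
    antisymmetry express its exponent by the end points, as [f] at the start plus [f] at the end.
    The other side of the QYBE gets the same factor. *)
Let twist123 z : weight_compat z ->
  forall a b c a2 b2 c2, let zt := diag2 t *m z *m diag2 t in
  mul123 zt zt zt (ix3 a b c) (ix3 a2 b2 c2) =
  E (f a b c) * E (f a2 b2 c2) * mul123 z z z (ix3 a b c) (ix3 a2 b2 c2).
Proof.
move=> wz a b c a2 b2 c2 /=; rewrite !leg12_13_23E mulr_sumr; apply: eq_bigr => a1 _.
rewrite mulr_sumr; apply: eq_bigr => b1 _; rewrite mulr_sumr; apply: eq_bigr => a' _.
rewrite mulr_sumr; apply: eq_bigr => c1 _; rewrite !diag2E.
have [->|/wz h1] := eqVneq (z (ix2 a b) (ix2 a1 b1)) 0; first by ring.
have [->|/wz h2] := eqVneq (z (ix2 a1 c) (ix2 a' c1)) 0; first by ring.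
have [->|/wz h3] := eqVneq (z (ix2 b1 c1) (ix2 b2 c2)) 0; first by ring.
have [ea|_] := eqVneq a' a2; last by rewrite !mulr0.
rewrite ea in h2 *.
transitivity (E (s a b + s a1 b1 + s a1 c + s a2 c1 + s b1 c1 + s b2 c2) *
    (z (ix2 a b) (ix2 a1 b1) * z (ix2 a1 c) (ix2 a2 c1) * (z (ix2 b1 c1) (ix2 b2 c2)))).
  by rewrite !ED /t mulr1; ring.
rewrite -ED mulr1; congr (E _ * _); rewrite /f.
have e1 : s a1 c = s a c + s b c - s b1 c by rewrite h1; ring.
have e2 : s a1 b1 = s a2 b1 + s c1 b1 - s c b1 by rewrite -h2; ring.
have e3 : s c1 a2 = s b2 a2 + s c2 a2 - s b1 a2 by rewrite -h3; ring.
rewrite e1 e2 (s_anti c1 a2) e3 (s_anti b1 c1) (s_anti b1 c) (s_anti b1 a2).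
by rewrite (s_anti a2 b2) (s_anti a2 c2); ring.
Qed.

Let twist321 z : weight_compat z ->
  forall a b c a2 b2 c2, let zt := diag2 t *m z *m diag2 t in
  mul321 zt zt zt (ix3 a b c) (ix3 a2 b2 c2) =
  E (f a b c) * E (f a2 b2 c2) * mul321 z z z (ix3 a b c) (ix3 a2 b2 c2).
Proof.
move=> wz a b c a2 b2 c2 /=; rewrite !leg23_13_12E mulr_sumr; apply: eq_bigr => b1 _.
rewrite mulr_sumr; apply: eq_bigr => c1 _; rewrite mulr_sumr; apply: eq_bigr => a1 _.
rewrite mulr_sumr; apply: eq_bigr => c' _; rewrite !diag2E.
have [->|/wz h1] := eqVneq (z (ix2 b c) (ix2 b1 c1)) 0; first by ring.
have [->|/wz h2] := eqVneq (z (ix2 a c1) (ix2 a1 c')) 0; first by ring.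
have [->|/wz h3] := eqVneq (z (ix2 a1 b1) (ix2 a2 b2)) 0; first by ring.
have [ec|_] := eqVneq c' c2; last by rewrite !mulr0.
rewrite ec in h2 *.
transitivity (E (s b c + s b1 c1 + s a c1 + s a1 c2 + s a1 b1 + s a2 b2) *
    (z (ix2 b c) (ix2 b1 c1) * z (ix2 a c1) (ix2 a1 c2) * (z (ix2 a1 b1) (ix2 a2 b2)))).
  by rewrite !ED /t mulr1; ring.
rewrite -ED mulr1; congr (E _ * _); rewrite /f.
have e1 : s c1 a = s b a + s c a - s b1 a by rewrite h1; ring.
have e2 : s a1 b1 = s a b1 + s c1 b1 - s c2 b1 by rewrite h2; ring.
have e3 : s a1 c2 = s a2 c2 + s b2 c2 - s b1 c2 by rewrite -h3; ring.
rewrite e2 e3 (s_anti c1 a) e1 (s_anti b1 c1) (s_anti b1 c2) (s_anti b1 a).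
by rewrite (s_anti a b) (s_anti a c); ring.
Qed.

Lemma QYBE_twist z : weight_compat z -> QYBE z ->
  QYBE (diag2 t *m z *m diag2 t).
Proof.
move=> wz; rewrite /QYBE => yb; apply: mx3P => a b c a2 b2 c2.
by rewrite [LHS]twist123 // [RHS]twist321 // /mul123 yb.
Qed.

(** Antisymmetry of [s] gives [P D = D^-1 P], so [P (D z D)] is conjugate to [P z], and a polynomial
    relation is preserved by conjugation. *)
Lemma hecke_defect_twist (p r : K) z : hecke_defect p r z = 0 ->
  hecke_defect p r (diag2 t *m z *m diag2 t) = 0.
Proof.
set P := Pmx K n; set D := diag2 t => H.
have PD : P *m D = diag2 (fun a b => E (- s a b)) *m P.
  apply: mx2P => a b c d; rewrite mul_PmxE mul_diag_mx !mxE !mxtens_indexK /= PmxE.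
  rewrite ix2_eq andbC; case: (a =P d) => [->|_]; case: (b =P c) => [->|_];
    by rewrite ?mulr0 // mulr1 /t (s_anti d c).
set D' := diag2 _ in PD.
have DD' : D *m D' = 1%:M.
  rewrite diag2M; apply/matrixP => x y; rewrite !mxE /t -ED subrr E0.
  by [].
have D'D : D' *m D = 1%:M by apply: mulmx1C.
have step u : P *m (D *m z *m D) + u%:M = D' *m (P *m z + u%:M) *m D.
  rewrite mulmxDr mulmxDl !mulmxA PD; congr (_ + _).
  by rewrite -mulmxA mul_scalar_mx -scalemxAr D'D scalemx1.
have stepN u : P *m (D *m z *m D) - u%:M = D' *m (P *m z - u%:M) *m D.
  by have := step (- u); rewrite rmorphN.
rewrite /hecke_defect -/P step stepN !mulmxA -[_ *m D *m D']mulmxA DD' mulmx1.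
by rewrite -[_ *m _ *m (_ + _)]mulmxA -/(hecke_defect p r z) H mulmx0 mul0mx.
Qed.

End Exponential.
End DiagonalTwist.

(** * The multiparameter standard R-matrix *)

Section StandardRMatrix.
Variables (K : comNzRingType) (n : nat) (q p : K).
Variables (x y : 'I_n -> 'I_n -> K) (z : 'M[K]_(n * n)).
Hypothesis zE : forall a b c d, z (ix2 a b) (ix2 c d) =
  x a b * ((a == c) && (b == d))%:R + y a b * ((a == d) && (b == c))%:R.
Hypothesis qp : q * p = 1.
Hypothesis xaa : forall a, x a a = q.
Hypothesis xab : forall a b, a != b -> x a b * x b a = 1.
Hypothesis yE : forall a b : 'I_n, y a b = if (b < a)%N then q - p else 0.

Let E a b c : 'rV[K]_(n * n * n) := delta_mx 0 (ix3 a b c).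

Let E_E a b c a' b' c' : E a b c 0 (ix3 a' b' c') = ([&& a == a', b == b' & c == c'])%:R.
Proof. by rewrite mxE eqxx !ix2_eq -!andbA eq_sym [b' == b]eq_sym [c' == c]eq_sym. Qed.

Let rv3P (u v : 'rV[K]_(n * n * n)) :
  (forall a b c, u 0 (ix3 a b c) = v 0 (ix3 a b c)) -> u = v.
Proof.
move=> uv; apply/rowP => t.
by case: (mxtens_indexP t) => t' c; case: (mxtens_indexP t') => a b.
Qed.

Let E12 a b c : E a b c *m leg12 z = x a b *: E a b c + y a b *: E b a c.
Proof.
apply: rv3P => a' b' c'; rewrite -rowE mxE leg12E zE mxDE !mxZE !E_E.
rewrite [(b == a') && _]andbA [(b == a') && _]andbC andbA.
by case: (c == c'); rewrite ?andbT ?andbF ?mulr1 ?mulr0 ?addr0.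
Qed.

Let E13 a b c : E a b c *m leg13 z = x a c *: E a b c + y a c *: E c b a.
Proof.
apply: rv3P => a' b' c'; rewrite -rowE mxE leg13E zE mxDE !mxZE !E_E.
rewrite [(c == a') && _]andbC.
by case: (b == b'); rewrite ?andbF ?mulr1 ?mulr0 ?addr0.
Qed.

Let E23 a b c : E a b c *m leg23 z = x b c *: E a b c + y b c *: E a c b.
Proof.
apply: rv3P => a' b' c'; rewrite -rowE mxE leg23E zE mxDE !mxZE !E_E.
rewrite [(c == b') && _]andbC.
by case: (a == a'); rewrite ?andbF ?mulr1 ?mulr0 ?addr0.
Qed.

(** The two sides of the QYBE applied to the row vector [E a b c], with [u] in place of the basis
    vectors. The terms in [E a b c], [E a c b] and [E b a c] agree on both sides and are left
    out. *)
Let std_coefs (a b c : 'I_n) (u : 'I_n -> 'I_n -> 'I_n -> K) :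
  x a b * (y a c * (x b a * u c b a + y b a * u c a b)) +
  y a b * (y b c * (x a b * u c a b + y a b * u c b a)) +
  y a b * (x b c * (y a c * u b c a)) =
  y b c * (x a b * (y a c * u c a b)) +
  y b c * (y a b * (x b c * u b c a + y b c * u c b a)) +
  x b c * (y a c * (x c b * u c b a + y c b * u b c a)).
Proof.
(* The quadratic equation of [q], which settles the cases [a = b] and [b = c]. *)
have q2 : q * q = 1 + (q - p) * q by rewrite -qp; ring.
have yaa d : y d d = 0 by rewrite yE ltnn.
have yy d e : y d e * y e d = 0 by rewrite !yE; case: ltngtP; rewrite ?mulr0 ?mul0r.
have nlt (d e : 'I_n) : (d < e)%N -> d != e.
  by move=> de; apply: contraTneq de => ->; rewrite ltnn.
have y2 d e : y d e * y d e = (q - p) * y d e by rewrite yE; case: ifP => _; ring.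
have [eab|nab] := eqVneq a b.
  subst b; rewrite yaa xaa.
  have [eac|nac] := eqVneq a c; first by subst c; rewrite yaa; ring.
  rewrite [RHS](_ : _ = y a c * y a c * (q * u c a a) + x a c * x c a * (y a c * u c a a)
    + x a c * (y a c * y c a) * u a c a); last by ring.
  rewrite (xab nac) y2 yy [LHS](_ : _ = q * q * (y a c * u c a a)); last by ring.
  by rewrite q2; ring.
have [ebc|nbc] := eqVneq b c.
  subst c; rewrite yaa xaa.
  rewrite [LHS](_ : _ = x a b * x b a * (y a b * u b b a)
    + x a b * (y a b * y b a) * u b a b + y a b * y a b * (q * u b b a)); last by ring.
  rewrite (xab nab) y2 yy [RHS](_ : _ = q * q * (y a b * u b b a)); last by ring.
  by rewrite q2; ring.
rewrite [LHS](_ : _ = x a b * x b a * (y a c * u c b a)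
  + x a b * u c a b * (y a c * y b a + y a b * y b c)
  + y a b * y a b * y b c * u c b a + x b c * u b c a * (y a b * y a c)); last by ring.
rewrite [RHS](_ : _ = x b c * x c b * (y a c * u c b a)
  + x a b * u c a b * (y b c * y a c) + y b c * y b c * y a b * u c b a
  + x b c * u b c a * (y b c * y a b + y a c * y c b)); last by ring.
rewrite (xab nab) (xab nbc) !y2.
(* What remains depends only on the relative order of the three indices; the branches in which the
   identity would fail are cyclic orders. *)
have e1 : y a c * y b a + y a b * y b c = y b c * y a c.
  rewrite !yE; case: (ltngtP a b) nab => [ab _|ba _|/val_inj ->]; last by rewrite eqxx.
    case: (ltnP c b) => cb; case: (ltnP c a) => ca; try by ring.
    by move: (leq_ltn_trans cb (ltn_trans ca ab)); rewrite ltnn.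
  case: (ltnP c b) => cb; case: (ltnP c a) => ca; try by ring.
  by move: (leq_ltn_trans ca (ltn_trans cb ba)); rewrite ltnn.
have e2 : y a b * y a c = y b c * y a b + y a c * y c b.
  rewrite !yE; case: (ltngtP b c) nbc => [bc _|cb _|/val_inj ->]; last by rewrite eqxx.
    case: (ltnP b a) => ba; case: (ltnP c a) => ca; try by ring.
    by move: (leq_ltn_trans ba (ltn_trans bc ca)); rewrite ltnn.
  case: (ltnP b a) => ba; case: (ltnP c a) => ca; try by ring.
  by move: (leq_ltn_trans ca (ltn_trans cb ba)); rewrite ltnn.
by rewrite e1 e2; ring.
Qed.

Lemma QYBE_standard : QYBE z.
Proof.
apply/row_matrixP => t; rewrite !rowE.
case: (mxtens_indexP t) => t' c; case: (mxtens_indexP t') => a b; rewrite -/(E a b c).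
rewrite !mulmxA.
do 3 rewrite ?(mulmxDl, =^~ scalemxAl, E12, E13, E23, scalerDr).
apply: rv3P => a' b' c'.
have /eqP := std_coefs a b c (fun d e f => E d e f 0 (ix3 a' b' c')).
rewrite -subr_eq0 => /eqP H; apply: subr0_eq; rewrite -[RHS]H /=.
by rewrite !(mxDE, mxZE); ring.
Qed.

Lemma hecke_standard : hecke_defect q p z = 0.
Proof.
pose e a b : 'rV[K]_(n * n) := delta_mx 0 (ix2 a b).
have ePz a b : e a b *m (Pmx K n *m z) = x b a *: e b a + y b a *: e a b.
  apply/rowP => t; case: (mxtens_indexP t) => c d.
  rewrite -rowE mxE mul_PmxE zE mxDE !mxZE !mxE eqxx !ix2_eq.
  by rewrite [c == b]eq_sym [d == a]eq_sym [c == a]eq_sym [d == b]eq_sym [(b == d) && _]andbC.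
apply/row_matrixP => t; rewrite !rowE mulmx0 /hecke_defect.
case: (mxtens_indexP t) => a b; rewrite -/(e a b).
rewrite mulmxA mulmxBr ePz mul_mx_scalar !(mulmxBl, mulmxDl) -!scalemxAl.
rewrite !mulmxDr !ePz !mul_mx_scalar; apply/rowP => s.
rewrite !(mxDE, mxZE, mxNE) [RHS]mxE.
have [eab|nab] := eqVneq a b.
  by subst b; rewrite xaa yE ltnn; ring.
rewrite [LHS](_ : _ = (x b a * x a b - q * p + y b a * (y b a - (q - p))) * e a b 0 s
  + x b a * (y a b + y b a - (q - p)) * e b a 0 s); last by ring.
rewrite [x b a * _]mulrC (xab nab) qp !yE.
by case: (ltngtP a b) nab => [_ _|_ _|/val_inj ->]; [ring|ring|rewrite eqxx].
Qed.

End StandardRMatrix.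

(** * Powers of q and the Cartan part r0 *)

Section QPowers.
Variable R : realType.
Local Notation C := R[i].
Local Notation A := (fps C).

Lemma qpowD (u v : C) : qpow (u + v) = qpow u * qpow v.
Proof.
apply: fpsP => m /=; rewrite addrC exprDn mulr_suml; apply: eq_bigr => i _.
have := ltn_ord i; rewrite ltnS => im; rewrite -(bin_fact im) !natrM.
have nz k : (k`!)%:R != 0 :> C by rewrite pnatr_eq0 -lt0n fact_gt0.
have nzb : ('C(m, i))%:R != 0 :> C by rewrite pnatr_eq0 -lt0n bin_gt0.
rewrite -mulr_natl !invfM mulrACA; move: (nz i) (nz (m - i)%N) => zi zm.
by field; rewrite zi zm nzb.
Qed.

Lemma qpow0 : qpow (0 : C) = 1.
Proof.
apply: fpsP => m /=; rewrite expr0n; case: m => [|m] /=; last by rewrite mul0r.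
by rewrite fact0 divr1.
Qed.

Lemma q_qV : q R * qV R = 1.
Proof. by rewrite -qpowD subrr qpow0. Qed.

Lemma fpsC0 : fpsC (0 : C) = 0.
Proof. by []. Qed.

End QPowers.

Lemma standard_entryE (K : pzRingType) n (k l : K) (a b c d : 'I_n) :
  (k *: (\sum_i tens K i i i i)
    + \sum_(i < n) \sum_(j < n | i != j) tens K i i j j
    + l *: (\sum_(i < n) \sum_(j < n | (j < i)%N) tens K i j j i))
  (ix2 a b) (ix2 c d) =
  (if a == b then k else 1) * ((a == c) && (b == d))%:R +
  (if (b < a)%N then l else 0) * ((a == d) && (b == c))%:R.
Proof.
rewrite mxDE mxDE mxZE mxZE.
rewrite [X in _ * X + _ + _]summxE.
rewrite [X in _ + X + _]summxE.
rewrite [X in _ + _ * X]summxE.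
have sumE (P : rel 'I_n) (F : 'I_n -> 'I_n -> 'M[K]_(n * n)) :
    (\sum_i (\sum_(j | P i j) F i j) (ix2 a b) (ix2 c d)) =
    \sum_i \sum_(j | P i j) F i j (ix2 a b) (ix2 c d).
  by apply: eq_bigr => i _; rewrite summxE.
rewrite (sumE (fun i j : 'I_n => i != j) (fun i j => tens K i i j j)).
rewrite (sumE (fun i j : 'I_n => (j < i)%N) (fun i j => tens K i j j i)).
have -> : \sum_i tens K i i i i (ix2 a b) (ix2 c d) = [&& a == b, a == c & b == d]%:R.
  rewrite (bigD1 a) //= [X in _ + X]big1 ?addr0 => [|i /negPf ia].
    rewrite tensE eqxx [b == a]eq_sym [c == a]eq_sym.
    by case: (a =P b) => [->|]; rewrite ?andbF //= [d == b]eq_sym.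
  by rewrite tensE eq_sym ia.
have -> : \sum_i \sum_(j | i != j) tens K i i j j (ix2 a b) (ix2 c d) =
    [&& a != b, a == c & b == d]%:R.
  rewrite (bigD1 a) //= [X in _ + X]big1 ?addr0 => [|i /negPf ia].
    rewrite big_mkcond (bigD1 b) //= [X in _ + X]big1 ?addr0 => [|j /negPf jb].
      by rewrite tensE !eqxx /= [c == a]eq_sym [d == b]eq_sym; case: (a == b).
    by rewrite tensE [b == j]eq_sym jb !andbF if_same.
  by rewrite big1 // => j _; rewrite tensE eq_sym ia.
have -> : \sum_(i < n) \sum_(j < n | (j < i)%N) tens K i j j i (ix2 a b) (ix2 c d) =
    [&& (b < a)%N, a == d & b == c]%:R.
  rewrite (bigD1 a) //= [X in _ + X]big1 ?addr0 => [|i /negPf ia].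
    rewrite big_mkcond (bigD1 b) //= [X in _ + X]big1 ?addr0 => [|j /negPf jb].
      rewrite tensE !eqxx /= [c == b]eq_sym [d == a]eq_sym [(b == c) && _]andbC.
      by case: ltnP.
    by rewrite tensE [b == j]eq_sym jb !andbF if_same.
  by rewrite big1 // => j _; rewrite tensE eq_sym ia.
by case: (a == b); case: ltnP => _; rewrite /= ?mulr0 ?mul0r ?addr0 ?add0r ?mul1r.
Qed.

Section CartanPart.
Variables (R : realType) (n : nat).
Local Notation C := R[i].
Local Notation A := (fps C).

Lemma wedgeE (x y : 'M[C]_n) (a b c d : 'I_n) :
  wedge x y (ix2 a b) (ix2 c d) = x a c * y b d - y a c * x b d.
Proof. by rewrite /wedge mxDE mxNE !tensmxE. Qed.

Lemma in_wedge_hE (r0 : 'M[C]_(n * n)) : in_wedge_h r0 ->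
  exists2 s : 'I_n -> 'I_n -> C, r0 = diag2 s & forall a b, s b a = - s a b.
Proof.
move=> [m [x [y ->]]].
exists (fun a b => \sum_(k < m) (x k 0 a * y k 0 b - y k 0 a * x k 0 b)).
  apply: mx2P => a b c d; rewrite summxE !mxE !mxtens_indexK /= ix2_eq -sumrMnl.
  apply: eq_bigr => k _; rewrite wedgeE !mxE.
  by case: (a == c); case: (b == d); rewrite ?mulr1n ?mulr0n ?mulr0 ?mul0r ?subr0.
move=> a b; rewrite -sumrN; apply: eq_bigr => k _.
by rewrite opprB [y k 0 b * _]mulrC [x k 0 b * _]mulrC.
Qed.

Lemma diag2_in_wedge_h (s : 'I_n -> 'I_n -> C) :
  (forall a b, s b a = - s a b) -> in_wedge_h (diag2 s).
Proof.
move=> s_anti.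
(* The wedge produces the coefficient at (a, b) twice, from [k = a] and, by antisymmetry, from
   [k = b]; hence the factor 2^-1. *)
exists n, (fun k => delta_mx 0 k), (fun k => \row_l (2^-1 * s k l)).
apply: mx2P => a b c d; rewrite summxE !mxE !mxtens_indexK /= ix2_eq.
under eq_bigr => k _.
  rewrite wedgeE !mxE eqxx /=.
  over.
rewrite sumrB (bigD1 a) //= [X in _ + X - _]big1 ?addr0; last first.
  by move=> k /negPf ka; rewrite eq_sym ka mul0rn mul0r.
rewrite (bigD1 b) //= [X in _ - (_ + X)]big1 ?addr0; last first.
  by move=> k /negPf kb; rewrite [b == k]eq_sym kb mul0rn mulr0.
rewrite !eqxx (s_anti a b).
case: (a == c); case: (b == d); rewrite ?mulr1n ?mulr0n ?mul0r ?mulr0 ?subrr //.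
have two : (2 : C) != 0 by rewrite pnatr_eq0.
by rewrite mulr1 mul1r; field.
Qed.

Lemma qpow_mx_diag2 (s : 'I_n -> 'I_n -> C) :
  qpow_mx (diag2 s) = diag2 (fun a b => qpow (s a b)).
Proof.
have pw m : diag2 s ^+ m = diag2 (fun a b => s a b ^+ m).
  elim: m => [|m IHm].
    by apply/matrixP => u v; rewrite !mxE.
  by rewrite exprS IHm [LHS]diag2M; congr diag_mx; apply/rowP => u; rewrite !mxE exprS.
apply/matrixP => u v; rewrite !mxE; apply: fpsP => m /=.
rewrite pw !mxE; case: eqP => _ //.
by rewrite mulr0n mul0r /= if_same.
Qed.

Lemma contract_diag2 (f : 'rV[C]_n) (s : 'I_n -> 'I_n -> C) :
  contract f (diag2 s) = diag_mx (\row_k \sum_i f 0 i * s i k).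
Proof.
apply/matrixP => k l; rewrite !mxE -sumrMnl; apply: eq_bigr => i _.
by rewrite /tcoef !mxE !mxtens_indexK /= ix2_eq eqxx /= mulrnAr.
Qed.

Lemma contract_P0mx (f : 'rV[C]_n) : contract f (P0mx C n) = diag_mx f.
Proof.
apply/matrixP => k l; rewrite !mxE.
rewrite (bigD1 k) //= [X in _ + X]big1 ?addr0 => [|i /negPf ik].
  by rewrite /tcoef P0mxE !eqxx /= mulr_natr.
by rewrite /tcoef P0mxE ik mulr0.
Qed.

Lemma R_sE (a b c d : 'I_n) : R_s R n (ix2 a b) (ix2 c d) =
  (if a == b then q R else 1) * ((a == c) && (b == d))%:R +
  (if (b < a)%N then q R - qV R else 0) * ((a == d) && (b == c))%:R.
Proof. exact: standard_entryE. Qed.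

(** By antisymmetry of [s] the twist leaves the coefficient q at e_aa (x) e_aa and the coefficients
    at e_ab (x) e_ba unchanged, and puts mutually inverse coefficients q^(2 s(a, b)) on the other
    diagonal entries: a multiparameter standard R-matrix. *)
Lemma standard_twisted (s : 'I_n -> 'I_n -> C) (s_anti : forall a b, s b a = - s a b) :
  let z := diag2 (fun a b => qpow (s a b)) *m R_s R n *m diag2 (fun a b => qpow (s a b)) in
  qybe_defect z = 0 /\ hecke_defect (q R) (qV R) z = 0.
Proof.
move=> z.
pose x a b := if a == b then q R else qpow (s a b) * qpow (s a b).
pose y (a b : 'I_n) := if (b < a)%N then q R - qV R else 0.
have saa a : s a a = 0.
  apply/eqP; have /eqP := s_anti a a; rewrite -addr_eq0 -mulr2n -mulr_natr mulf_eq0.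
  by rewrite pnatr_eq0 orbF.
have zE a b c d : z (ix2 a b) (ix2 c d) =
    x a b * ((a == c) && (b == d))%:R + y a b * ((a == d) && (b == c))%:R.
  rewrite diag2E R_sE mulrDr mulrDl /x /y; congr (_ + _).
    case: (a =P c) => [<-|_]; last by rewrite !mulr0 mul0r.
    case: (b =P d) => [<-|_]; last by rewrite !mulr0 mul0r.
    by case: (a =P b) => [<-|_]; rewrite ?saa ?qpow0 !mulr1 ?mul1r.
  case: (a =P d) => [<-|_]; last by rewrite !mulr0 mul0r.
  case: (b =P c) => [<-|_]; last by rewrite !mulr0 mul0r.
  by rewrite !mulr1 mulrAC -qpowD (s_anti a b) subrr qpow0 mul1r.
have xab a b : a != b -> x a b * x b a = 1.
  move=> ab; rewrite /x [b == a]eq_sym (negPf ab) (s_anti a b) mulrACA -!qpowD.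
  by rewrite !subrr addr0 qpow0.
have xaa a : x a a = q R by rewrite /x eqxx.
by split; [apply/QYBEP; apply: QYBE_standard zE (q_qV R) xaa xab _
          | apply: hecke_standard zE (q_qV R) xaa xab _].
Qed.

End CartanPart.

(** * Positive roots as intervals of simple roots, and potentials along tau *)

Section RootSupport.
Variables (R : realType) (n : nat).
Local Notation C := R[i].
Implicit Types (a b c : posroot n) (k l m : 'I_n.-1) (Y : {set 'I_n.-1}).

Definition supp a : {set 'I_n.-1} := [set k : 'I_n.-1 | (src a <= k < tgt a)%N].

Lemma src_lt_tgt a : (src a < tgt a)%N.
Proof. exact: (valP a). Qed.

Lemma ord_pred_succ_lt k : (k.+1 < n)%N.
Proof. by rewrite -ltn_predRL; apply: ltn_ord. Qed.

Lemma supp_src a : exists2 k : 'I_n.-1, k \in supp a & nat_of_ord k = src a.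
Proof.
have lt := src_lt_tgt a.
have sn : (src a < n.-1)%N.
  by rewrite ltn_predRL (leq_ltn_trans lt) // ltn_ord.
by exists (Ordinal sn); rewrite // inE leqnn.
Qed.

Lemma supp_neq0 a : (0 < #|supp a|)%N.
Proof. by have [k ka _] := supp_src a; rewrite card_gt0; apply/set0Pn; exists k. Qed.

Lemma sum_supp (V : nmodType) (f : nat -> V) a :
  \sum_(k : 'I_n.-1 | k \in supp a) f k = \sum_(src a <= k < tgt a) f k.
Proof.
rewrite big_geq_mkord [RHS](big_ord_widen_cond n.-1 (fun k : nat => (src a <= k)%N) f).
  by apply: eq_bigl => k; rewrite inE.
by rewrite -ltnS; apply: leq_trans (ltn_ord _) (leqSpred n).
Qed.

Lemma root_vec_sum a : root_vec R a = \sum_(k : 'I_n.-1 | k \in supp a) simple_root R k.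
Proof.
transitivity (\sum_(src a <= k < tgt a) (e R n k - e R n k.+1)); last first.
  exact/esym/(sum_supp (fun k : nat => e R n k - e R n k.+1)).
rewrite -[RHS]opprK -sumrN.
under eq_bigr do rewrite opprB.
by rewrite telescope_sumr ?opprB // ltnW // src_lt_tgt.
Qed.

(** Pairing with a fundamental weight: the linear form that reads off the coefficient of the simple
    root with index [k]. *)
Definition psum k (v : 'rV[C]_n) : C := \sum_(j < n | (j <= k)%N) v 0 j.

Lemma psum_e k (m : nat) : (m < n)%N -> psum k (e R n m) = (m <= k)%:R.
Proof.
move=> mn; rewrite /psum; case: leqP => mk.
  rewrite (bigD1 (Ordinal mn)) //= mxE eqxx big1 ?addr0 // => j /andP[_ jm].
  by rewrite mxE; case: eqP => // jm'; case/eqP: jm; apply: val_inj.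
rewrite big1 // => j jk; rewrite mxE; case: eqP => // jm.
by rewrite jm leqNgt mk in jk.
Qed.

Lemma psumB k (u v : 'rV[C]_n) : psum k (u - v) = psum k u - psum k v.
Proof. by rewrite /psum -sumrB; apply: eq_bigr => j _; rewrite !mxE. Qed.

Lemma psum_sum k (J : Type) (r : seq J) (P : pred J) (F : J -> 'rV[C]_n) :
  psum k (\sum_(j <- r | P j) F j) = \sum_(j <- r | P j) psum k (F j).
Proof.
by rewrite /psum exchange_big; apply: eq_bigr => j _; rewrite summxE.
Qed.

Lemma psumZ k x (v : 'rV[C]_n) : psum k (x *: v) = x * psum k v.
Proof. by rewrite /psum mulr_sumr; apply: eq_bigr => j _; rewrite mxE. Qed.

Lemma psum_simple_root k m : psum k (simple_root R m) = (m == k)%:R.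
Proof.
have mn := ord_pred_succ_lt m.
rewrite psumB !psum_e ?(ltnW mn) // -val_eqE /=.
by case: ltngtP; rewrite ?subrr ?subr0.
Qed.

Lemma psum_root_vec k a : psum k (root_vec R a) = (k \in supp a)%:R.
Proof.
rewrite psumB !psum_e ?ltn_ord // inE ltnNge.
have := src_lt_tgt a; case: (leqP (tgt a) k) => [tk st|tk _].
  by rewrite (leq_trans (ltnW st) tk) subrr.
by rewrite subr0 andbT.
Qed.

Lemma mem_tilde a Y : (a \in tilde R Y) = (supp a \subset Y).
Proof.
rewrite inE; apply/idP/idP => [aY|/subsetP aY]; last first.
  rewrite root_vec_sum; apply: memv_suml => k /aY kY.
  by apply: memv_span; apply: map_f; rewrite mem_enum.
apply/subsetP => k ka; apply/negPn/negP => kY.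
have := psum_root_vec k a; rewrite ka.
rewrite (coord_span (X := in_tuple _) aY) psum_sum big1 => [/esym/eqP|j _].
  by rewrite oner_eq0.
rewrite psumZ.
have /mapP[m mY ->] : (in_tuple [seq simple_root R m | m <- enum Y])`_j
    \in [seq simple_root R m | m <- enum Y] by apply: mem_nth.
rewrite psum_simple_root; case: eqP => [mk|]; last by rewrite mulr0.
by rewrite -mk -mem_enum mY in kY.
Qed.

Lemma dot_simple_root_eq0 k l :
  dot (simple_root R k) (simple_root R l) = 0 -> (k.+1 < l)%N || (l.+1 < k)%N.
Proof.
have dot_e (x y : nat) : (x < n)%N -> dot (e R n x) (e R n y) = (x == y)%:R.
  move=> xn; rewrite /dot (bigD1 (Ordinal xn)) //= !mxE eqxx mul1r big1 ?addr0 //.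
  move=> j jx; rewrite !mxE; case: eqP => [jx'|]; last by rewrite mul0r.
  by case/eqP: jx; apply: val_inj.
have dotBl (u v w : 'rV[C]_n) : dot (u - v) w = dot u w - dot v w.
  by rewrite /dot -sumrB; apply: eq_bigr => j _; rewrite !mxE mulrBl.
have dotBr (u v w : 'rV[C]_n) : dot u (v - w) = dot u v - dot u w.
  by rewrite /dot -sumrB; apply: eq_bigr => j _; rewrite !mxE mulrBr.
have kn := ord_pred_succ_lt k.
rewrite dotBl !dotBr !dot_e ?(ltnW kn) // eqSS.
have two : (1 + 1 : C) != 0 by rewrite -(natrD _ 1 1) pnatr_eq0.
have ne1 (x : nat) : (x == x.+1) = false by rewrite ltn_eqF.
have ne2 (x : nat) : (x == x.+2) = false by rewrite ltn_eqF.
apply: contra_eqT; rewrite negb_or -!leqNgt => /andP[lk kl].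
have [h|h|e] := ltngtP k l.
- have -> : l = k.+1 :> nat by apply/eqP; rewrite eqn_leq lk h.
  by rewrite eqxx ne2 !subr0 sub0r oppr_eq0 oner_eq0.
- have -> : k = l.+1 :> nat by apply/eqP; rewrite eqn_leq kl h.
  by rewrite eqxx [_.+2 == _]eq_sym ne2 !subr0 sub0r oppr_eq0 oner_eq0.
by rewrite e ne1 [_.+1 == _]eq_sym ne1 subr0 sub0r opprK.
Qed.

Lemma bd_orthogonalP X Y k l : bd_orthogonal R X Y -> k \in X -> l \in Y ->
  (k.+1 < l)%N || (l.+1 < k)%N.
Proof. by move=> oXY kX lY; apply: dot_simple_root_eq0; apply: oXY. Qed.

Section Heights.
Variable f : 'I_n.-1 -> nat.

Definition hsum (a : posroot n) : nat := \sum_(k in supp a) f k.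
(** Diagonal weights that integrate [f]: in the resulting grading e_(-alpha) has degree
    [hsum f alpha], and e_beta has degree minus [hsum f beta]. *)
Definition hgt (j : 'I_n) : nat := \sum_(k : 'I_n.-1 | (j <= k)%N) f k.

Lemma hgtE a : hgt (src a) = (hsum a + hgt (tgt a))%N.
Proof.
rewrite /hgt (bigID (fun k : 'I_n.-1 => (k < tgt a)%N)) /=; congr (_ + _)%N.
  by apply: eq_bigl => k; rewrite inE.
apply: eq_bigl => k; rewrite -leqNgt andbC.
by have [tk|//] := leqP (tgt a) k; rewrite (leq_trans _ tk) // ltnW // src_lt_tgt.
Qed.

End Heights.

Section TauPowers.
Variable T : bd_triple R n.

(** The coefficient of each simple root is compared on both sides of the step: for the root [b] it
    is 0 or 1, for [tau_vec] it counts preimages in [supp a]. *)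
Lemma supp_tau_step a b : tau_step T a b ->
  supp a \subset Gamma1 T /\ supp b = tau T @: supp a.
Proof.
case/andP; rewrite mem_tilde => aT /eqP ab; split=> //; apply/setP => m.
have: ((m \in supp b)%:R : C) = (\sum_(k in supp a) (tau T k == m))%:R.
  rewrite -psum_root_vec ab psum_sum natr_sum.
  by apply: eq_big => k; rewrite ?inE // => _; rewrite psum_simple_root.
move/eqP; rewrite eqr_nat => /eqP mE; apply/idP/imsetP => [mb|[k ka em]].
  move: mE; rewrite mb.
  have [k /andP[ka /eqP <-]|nk] := pickP (fun k => (k \in supp a) && (tau T k == m)).
    by exists k.
  by rewrite big1 // => k ka; have := nk k; rewrite ka /= => ->.
subst m; by move: mE; rewrite (bigD1 k) //= eqxx; case: (tau T k \in supp b).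
Qed.

Lemma tau_pow_supp p a b : tau_pow T p.+1 a b ->
  supp a \subset Gamma1 T /\ supp b \subset Gamma2 T.
Proof.
elim: p a => [|p IHp] a /= /existsP[c /andP[ac cb]]; have [aT sc] := supp_tau_step ac.
  by move/eqP: cb => <-; split=> //; rewrite sc -(bd_image T) imsetS.
by split=> //; case: (IHp _ cb).
Qed.

Lemma prec_supp a b : prec T a b -> supp a \subset Gamma1 T /\ supp b \subset Gamma2 T.
Proof. by move=> /asboolP[[|p] [//]] _; apply: tau_pow_supp. Qed.

Section Potential.
Variables (f : 'I_n.-1 -> nat) (c0 : nat).
Hypothesis fP : {in Gamma1 T, forall k, f k = c0 + f (tau T k)}%N.

Lemma hsum_tau_step a b : tau_step T a b ->
  hsum f a = (c0 * #|supp a| + hsum f b)%N.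
Proof.
rewrite /hsum => /supp_tau_step[/subsetP aT ->]; rewrite big_imset /=; last first.
  by move=> k l /aT kT /aT lT; apply: bd_inj.
rewrite -sum1_card big_distrr -big_split /=.
by apply: eq_bigr => k /aT kT; rewrite muln1 fP.
Qed.

(** Each application of tau lowers [hsum] by [c0] for every simple root in the support, hence by at
    least [c0]. *)
Lemma hsum_tau_pow_le p a b : tau_pow T p a b -> (c0 * p + hsum f b <= hsum f a)%N.
Proof.
elim: p a => [|p IHp] a /=; first by move=> /eqP ->; rewrite muln0.
case/existsP=> c /andP[/hsum_tau_step -> /IHp cb].
by rewrite mulnSr addnAC addnC leq_add // leq_pmulr // supp_neq0.
Qed.

Lemma hsum_tau_pow_eq p a b : c0 = 0%N -> tau_pow T p a b -> hsum f a = hsum f b.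
Proof.
move=> c00; elim: p a => [|p IHp] a /=; first by move=> /eqP ->.
by case/existsP=> c /andP[/hsum_tau_step -> /IHp ->]; rewrite c00.
Qed.

End Potential.

(** The solution is the sum of [c] along the orbit until it leaves [Gamma1], finite by nilpotency.
    The recursion runs on fuel; [N] is the largest first exit time, past which more fuel changes
    nothing. *)
Lemma potential_exists (c : 'I_n.-1 -> nat) :
  exists f : 'I_n.-1 -> nat, {in Gamma1 T, forall k, f k = c k + f (tau T k)}%N.
Proof.
pose fuel := fix fuel N k : nat :=
  if N is N'.+1 then if k \in Gamma1 T then (c k + fuel N' (tau T k))%N else 0%N else 0%N.
have escape k : exists p, iter p (tau T) k \notin Gamma1 T.
  by have [/bd_nilp //|kT] := boolP (k \in Gamma1 T); exists 0%N.
pose N := \max_k ex_minn (escape k).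
have stable M p k : iter p (tau T) k \notin Gamma1 T -> (p <= M)%N ->
    fuel M.+1 k = fuel M k.
  elim: M p k => [|M IHM] [|p] k //=; try by move=> /negPf ->.
  rewrite -iterS iterSr => pk pM; case: ifP => // _.
  by congr (_ + _)%N; apply: IHM pk pM.
exists (fuel N) => k kT.
rewrite -(stable N (ex_minn (escape k)) k); [by rewrite /= kT|by case: ex_minnP|].
exact: (leq_bigmax k).
Qed.

Lemma tau_pow_bounded : exists N, forall p a b, tau_pow T p a b -> (p <= N)%N.
Proof.
have [f fP] := potential_exists (fun=> 1%N).
exists (\max_a hsum f a) => p a b /(hsum_tau_pow_le fP).
rewrite mul1n => pa; apply: leq_trans (leq_bigmax a).
exact: leq_trans (leq_addr _ _) pa.
Qed.

End TauPowers.
End RootSupport.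

(** * Combinatorics of a tau-orthogonal union *)

Section OrthogonalUnion.
Variables (R : realType) (n : nat) (I : finType).
Variables (T : bd_triple R n) (F : I -> bd_triple R n).
Hypothesis hTF : bd_tau_orthogonal_union T F.
Implicit Types (a b c : posroot n) (k l : 'I_n.-1) (i j : I).

Let orth1 i j : i != j -> bd_orthogonal R (Gamma1 (F i)) (Gamma1 (F j)).
Proof. by case: hTF => -[_ o] _ /o []. Qed.

Let orth2 i j : i != j -> bd_orthogonal R (Gamma2 (F i)) (Gamma2 (F j)).
Proof. by case: hTF => -[_ o] _ /o []. Qed.

Lemma Gamma1_union_sub i : Gamma1 (F i) \subset Gamma1 T.
Proof. by case: hTF => -[[-> _ _] _] _; apply: (bigcup_sup i). Qed.

Lemma tau_union i : {in Gamma1 (F i), tau T =1 tau (F i)}.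
Proof. by case: hTF => -[[_ _ tF] _] _; apply: tF. Qed.

Let tau_orth i : Gamma2 (F i) :&: Gamma1 T \subset Gamma1 (F i).
Proof. by case: hTF. Qed.

Lemma Gamma1_unique i j k : k \in Gamma1 (F i) -> k \in Gamma1 (F j) -> i = j.
Proof.
move=> ki kj; have [//|ij] := eqVneq i j.
have := bd_orthogonalP (orth1 ij) ki kj.
by rewrite ltnNge leqnSn.
Qed.

Let Gamma21_disjoint i j k : i != j -> k \in Gamma2 (F i) -> k \in Gamma1 (F j) -> False.
Proof.
move=> ij k2 k1; have kT : k \in Gamma1 T by apply: (subsetP (Gamma1_union_sub j)).
have /(subsetP (tau_orth i)) ki : k \in Gamma2 (F i) :&: Gamma1 T by rewrite inE k2.
by case/eqP: ij; apply: Gamma1_unique ki k1.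
Qed.

Lemma supp_Gamma1_unique i j a :
  supp a \subset Gamma1 (F i) -> supp a \subset Gamma1 (F j) -> i = j.
Proof.
have [k ka _] := supp_src a => /subsetP/(_ k ka) ki /subsetP/(_ k ka) kj.
exact: Gamma1_unique ki kj.
Qed.

(* A connected segment of [Gamma1] cannot meet two mutually orthogonal pieces. *)
Lemma supp_Gamma1_exists a : supp a \subset Gamma1 T ->
  exists i, supp a \subset Gamma1 (F i).
Proof.
move=> /subsetP aT; have [k0 k0a k0E] := supp_src a.
have inF k : k \in supp a -> exists i, k \in Gamma1 (F i).
  move=> /aT; case: hTF => -[[-> _ _] _] _ /bigcupP[i _ ki].
  by exists i.
have [i k0i] := inF _ k0a; exists i; apply/subsetP => k ka.
have: (src a <= k)%N by move: ka; rewrite inE => /andP[].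
rewrite -k0E => /subnKC; move: (k - k0)%N => m.
elim: m k ka => [|m IHm] k ka; first by rewrite addn0 => /val_inj <-.
rewrite addnS => ek.
have k'lt : (k0 + m < n.-1)%N by rewrite (leq_trans _ (ltn_ord k)) // -ek.
have k'a : Ordinal k'lt \in supp a.
  rewrite inE /= -k0E leq_addr /=.
  by move: ka; rewrite inE -ek => /andP[_]; apply: leq_trans; rewrite leqnSn.
have k'i := IHm _ k'a erefl; have [j kj] := inF _ ka.
have [->//|ij] := eqVneq i j.
have := bd_orthogonalP (orth1 ij) k'i kj.
by rewrite /= -ek ltnn ltnNge (leq_trans (leqnSn _) (leqnSn _)).
Qed.

Lemma tau_step_union i a c : supp a \subset Gamma1 (F i) ->
  tau_step T a c = tau_step (F i) a c.
Proof.
move=> ai; rewrite /tau_step !mem_tilde ai (subset_trans ai (Gamma1_union_sub i)).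
congr (_ == _); apply: eq_bigr => k ka; rewrite (@tau_union i) //.
by apply: (subsetP ai); rewrite inE.
Qed.

Let supp_back i c : supp c \subset Gamma2 (F i) -> supp c \subset Gamma1 T ->
  supp c \subset Gamma1 (F i).
Proof. by move=> c2 c1; apply: subset_trans (tau_orth i); rewrite subsetI c2. Qed.

Lemma tau_pow_union p i a b : supp a \subset Gamma1 (F i) ->
  tau_pow T p a b = tau_pow (F i) p a b.
Proof.
elim: p a => [//|p IHp] a ai /=; apply: eq_existsb => c.
rewrite (tau_step_union _ ai); have [ac|//] := boolP (tau_step (F i) a c).
have c2 : supp c \subset Gamma2 (F i).
  by have [_ ->] := supp_tau_step ac; rewrite -(bd_image (F i)) imsetS.
(* If tau is applied again, tau-orthogonality brings [c] back into the piece. The final value may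
   lie outside [Gamma1], whence the case distinction on [p]. *)
rewrite /=; case: p IHp => [//|p] IHp.
by apply/idP/idP => cb; have [c1 _] := tau_pow_supp cb;
  [rewrite -IHp | rewrite IHp] => //; apply: supp_back c2 _ ;
  rewrite // (subset_trans c1) // Gamma1_union_sub.
Qed.

Lemma prec_union i a b : supp a \subset Gamma1 (F i) -> prec T a b = prec (F i) a b.
Proof.
move=> ai; apply: asbool_equiv_eq; split=> -[p [p0 pab]]; exists p; split=> //.
  by rewrite -tau_pow_union.
by rewrite (tau_pow_union _ _ ai).
Qed.

(** For the intermediate roots gamma in K: as a value of tau, such a root is supported in
    [Gamma2 (F i)], and as it has a further image, also in [Gamma1 T]. *)
Lemma prec_union_mid i a b c : prec (F i) a c -> prec T c b = prec (F i) c b.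
Proof.
move=> /prec_supp[_ c2]; apply/idP/idP => cb; have [c1 _] := prec_supp cb.
  by rewrite -prec_union // supp_back.
by rewrite (prec_union _ (i := i)) // supp_back // (subset_trans c1) // Gamma1_union_sub.
Qed.

Lemma iter_tau_union p i a b k : tau_pow (F i) p a b -> k \in supp a ->
  iter p (tau T) k = iter p (tau (F i)) k.
Proof.
elim: p a k => [//|p IHp] a k /= /existsP[c /andP[/supp_tau_step[/subsetP ai sc] cb]] ka.
rewrite -!iterS !iterSr (tau_union (ai k ka)).
by apply: IHp cb _; rewrite sc imset_f.
Qed.

Lemma mem_supp_src k a : nat_of_ord k = src a -> k \in supp a.
Proof. by rewrite inE => ->; rewrite leqnn src_lt_tgt. Qed.

Lemma prec_left_union i a b : supp a \subset Gamma1 (F i) ->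
  prec_left T a b = prec_left (F i) a b.
Proof.
move=> ai; apply: asbool_equiv_eq.
split=> -[p [k [l [[p0 pab a2] [ka lb pkl]]]]]; exists p, k, l.
  have pab' : tau_pow (F i) p a b by rewrite -tau_pow_union.
  by rewrite -(iter_tau_union pab' (mem_supp_src ka)).
rewrite (tau_pow_union _ _ ai).
by rewrite (iter_tau_union pab (mem_supp_src ka)).
Qed.

Lemma prec_right_union i a b : supp a \subset Gamma1 (F i) ->
  prec_right T a b = prec_right (F i) a b.
Proof.
move=> ai; apply: asbool_equiv_eq.
split=> -[p [k [l [[p0 pab a2] [ka lb pkl]]]]]; exists p, k, l.
  have pab' : tau_pow (F i) p a b by rewrite -tau_pow_union.
  by rewrite -(iter_tau_union pab' (mem_supp_src ka)).
rewrite (tau_pow_union _ _ ai).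
by rewrite (iter_tau_union pab (mem_supp_src ka)).
Qed.

Lemma sign_union i a b : supp a \subset Gamma1 (F i) -> sign T a b = sign (F i) a b.
Proof. by move=> ai; rewrite /sign (prec_left_union _ ai) (prec_right_union _ ai). Qed.

Lemma Kexp_union i a b : supp a \subset Gamma1 (F i) -> Kexp T a b = Kexp (F i) a b.
Proof.
move=> ai; rewrite /Kexp (prec_left_union _ ai).
have mid (Q : posroot n -> bool) :
    iverson R (exists c, [/\ prec T a c, prec T c b & Q c]) =
    iverson R (exists c, [/\ prec (F i) a c, prec (F i) c b & Q c]).
  rewrite /iverson; congr (nat_of_bool _)%:R; apply: asbool_equiv_eq.
  split=> -[c [ac cb Qc]]; exists c; rewrite (prec_union _ ai) in ac *.
    by rewrite -(prec_union_mid _ ac).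
  by rewrite (prec_union_mid _ ac).
by rewrite (mid (fun c => lessdot a c)) (mid (fun c => lessdot c a)).
Qed.

(* Matrix units e_(x,y) occurring in a leg of a(F i): either -alpha with alpha
   in the span of Gamma1, or beta in the span of Gamma2. *)
Definition leg_of (S : bd_triple R n) (x y : 'I_n) : Prop :=
  ((y < x)%N /\ forall k, (y <= k < x)%N -> k \in Gamma1 S) \/
  ((x < y)%N /\ forall k, (x <= k < y)%N -> k \in Gamma2 S).

Lemma leg_of_neg (S : bd_triple R n) a : supp a \subset Gamma1 S ->
  leg_of S (tgt a) (src a).
Proof.
move=> /subsetP aS; left; split=> [|k ka]; first exact: src_lt_tgt.
by apply: aS; rewrite inE.
Qed.

Lemma leg_of_pos (S : bd_triple R n) a : supp a \subset Gamma2 S ->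
  leg_of S (src a) (tgt a).
Proof.
move=> /subsetP aS; right; split=> [|k ka]; first exact: src_lt_tgt.
by apply: aS; rewrite inE.
Qed.

Let below (x y : 'I_n) : (x < y)%N -> exists2 k : 'I_n.-1, (x <= k < y)%N & k.+1 = y.
Proof.
move=> xy; have y0 : (0 < y)%N by apply: leq_ltn_trans xy.
have lt : (y.-1 < n.-1)%N by rewrite ltn_predRL prednK // ltn_ord.
by exists (Ordinal lt); rewrite /= ?prednK // leqnn andbT -ltnS prednK.
Qed.

Let above (x y : 'I_n) : (x < y)%N -> exists2 k : 'I_n.-1, (x <= k < y)%N & k = x :> nat.
Proof.
move=> xy; have lt : (x < n.-1)%N by rewrite ltn_predRL (leq_ltn_trans xy) // ltn_ord.
by exists (Ordinal lt); rewrite /= ?leqnn.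
Qed.

Let adjacent (k l : 'I_n.-1) : k.+1 = l -> (k.+1 < l)%N || (l.+1 < k)%N -> False.
Proof. by move=> <-; rewrite ltnn ltnNge (leq_trans (leqnSn _) (leqnSn _)). Qed.

(** The intervals of the two roots meet at [y]. If the roots have the same sign, the intervals are
    adjacent there, against orthogonality of the pieces of [Gamma1] or of [Gamma2]. If the signs
    differ, the intervals share a simple root, which lies in [Gamma1] of one piece and [Gamma2] of
    the other, against tau-orthogonality. *)
Lemma leg_excl_union i j : i != j -> leg_excl (leg_of (F i)) (leg_of (F j)).
Proof.
move=> ij x y z [[yx xy]|[xy yx]] [[zy yz]|[yz zy]].
- have [k kI ky] := above yx; have [l lI ly] := below zy.
  apply: (adjacent (k := l) (l := k)); first by rewrite ky ly.
  by rewrite orbC; apply: bd_orthogonalP (orth1 ij) (xy _ kI) (yz _ lI).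
- have [k kI ky] := above yx; have [l lI ly] := above yz.
  have kl : k = l by apply: val_inj; rewrite /= ky ly.
  by apply: (@Gamma21_disjoint j i k); rewrite 1?eq_sym ?kl ?zy // -kl xy.
- have [k kI ky] := below xy; have [l lI ly] := below zy.
  have kl : k = l by apply/val_inj/succn_inj; rewrite /= ky ly.
  by apply: (@Gamma21_disjoint i j k); rewrite ?yx // kl yz.
- have [k kI ky] := below xy; have [l lI ly] := above yz.
  apply: (adjacent (k := k) (l := l)); first by rewrite ky ly.
  exact: bd_orthogonalP (orth2 ij) (yx _ kI) (zy _ lI).
Qed.

End OrthogonalUnion.

(** * Unipotent matrices and their inverses in a grading *)

Section Unipotent.
Variables (K : comUnitRingType) (N : nat).
Implicit Types (h : 'I_N -> nat) (A B : 'M[K]_N).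

Definition spos h A : Prop := forall x y, A x y != 0 -> (h x < h y)%N.

Lemma spos_nneg h A : spos h A -> nneg h A.
Proof. by move=> sA x y /sA /ltnW. Qed.

Lemma sposM h A B : spos h A -> nneg h B -> spos h (A *m B).
Proof.
move=> sA nB x y; rewrite mxE; apply: contraR; rewrite -leqNgt => yx.
rewrite big1 // => k _; have [->|/sA xk] := eqVneq (A x k) 0; first by rewrite mul0r.
have [->|/nB ky] := eqVneq (B k y) 0; first by rewrite mulr0.
by have := leq_trans xk (leq_trans ky yx); rewrite ltnn.
Qed.

Lemma sposD h A B : spos h A -> spos h B -> spos h (A + B).
Proof.
move=> sA sB x y; rewrite mxE; have [A0|/sA //] := eqVneq (A x y) 0.
by rewrite A0 add0r => /sB.
Qed.

Lemma spos_exp h A k x y : spos h A -> (A ^+ k) x y != 0 -> (h x + k <= h y)%N.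
Proof.
move=> sA; elim: k x y => [|k IHk] x y.
  by rewrite !mxE addn0; case: (x =P y) => [->|] //; rewrite eqxx.
rewrite exprS mxE; apply: contraR; rewrite -ltnNge => yx.
rewrite big1 // => l _; have [->|/sA xl] := eqVneq (A x l) 0; first by rewrite mul0r.
have [->|/IHk ly] := eqVneq ((A ^+ k) l y) 0; first by rewrite mulr0.
by rewrite -addSnnS in yx; have := leq_trans yx (leq_trans (leq_add xl (leqnn k)) ly); rewrite ltnn.
Qed.

(** A nonzero entry of the [k]-th power raises the weight by at least [k], so large powers vanish.
    All large truncations of the geometric series are provided, so that two inverses can be written
    with a common one. *)
Lemma invmx_unipotent h B : spos h B ->
  exists M0, forall M, (M0 <= M)%N ->
  (1 + B \in unitmx) /\ invmx (1 + B) = \sum_(k < M) (- B) ^+ k.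
Proof.
move=> sB; exists (\max_y h y).+1 => M leM.
have sB' : spos h (- B) by move=> x y; rewrite mxE oppr_eq0; apply: sB.
have nil : (- B) ^+ M = 0.
  apply/matrixP => x y; rewrite [RHS]mxE; apply/eqP; apply: contraT => /(spos_exp sB').
  move/(leq_trans (leq_addl _ _))/(leq_trans leM).
  by move=> lt; rewrite ltnNge leq_bigmax in lt.
have inv : (1 + B) *m \sum_(k < M) (- B) ^+ k = 1%:M.
  have := subrX1 (- B) M; rewrite nil sub0r -opprD mulNr => /oppr_inj/esym.
  by rewrite [B + 1]addrC.
have [u _] := mulmx1_unit inv; split=> //.
by rewrite -[RHS](mulKmx u) inv mulmx1.
Qed.

Lemma nneg_prod h (F : nat -> 'M[K]_N) M :
  (forall p, nneg h (F p)) -> nneg h (\prod_(0 <= p < M) F p).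
Proof.
move=> nF; elim: M => [|M IHM]; first by rewrite big_nil; apply: nneg_scalar.
by rewrite big_nat_recr //=; apply: nnegM.
Qed.

Lemma deg0_prod h (F : nat -> 'M[K]_N) M :
  (forall p, nneg h (F p)) ->
  deg0 h (\prod_(0 <= p < M) F p) = \prod_(0 <= p < M) deg0 h (F p).
Proof.
move=> nF; elim: M => [|M IHM]; first by rewrite !big_nil; apply: deg0_scalar.
by rewrite !big_nat_recr //= deg0M ?IHM //; apply: nneg_prod.
Qed.

Lemma nneg_exp h A k : nneg h A -> nneg h (A ^+ k).
Proof.
move=> nA; elim: k => [|k IHk]; first by apply: nneg_scalar.
by rewrite exprS; apply: nnegM.
Qed.

Lemma deg0_exp h A k : nneg h A -> deg0 h (A ^+ k) = deg0 h A ^+ k.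
Proof.
move=> nA; elim: k => [|k IHk]; first by apply: deg0_scalar.
by rewrite !exprS deg0M ?IHk //; apply: nneg_exp.
Qed.

Lemma spos_prod1B h (F : nat -> 'M[K]_N) M :
  (forall p, spos h (F p)) -> spos h (\prod_(0 <= p < M) (1 + F p) - 1).
Proof.
move=> sF; elim: M => [|M IHM]; first by rewrite big_nil subrr => x y; rewrite mxE eqxx.
rewrite big_nat_recr //= mulrDr mulr1 addrAC; apply: sposD => //.
rewrite -[X in X * _](subrK 1) mulrDl mul1r; apply: sposD => //.
by apply: sposM => //; apply: spos_nneg.
Qed.

Lemma unipotent_unitmx h A : spos h (A - 1) -> A \in unitmx.
Proof.
by case/invmx_unipotent => M0 /(_ M0 (leqnn _))[]; rewrite [1 + _]addrC subrK.
Qed.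

(** The two inverses are the same polynomial in [A] and in [deg0 h A], and taking degree 0 parts is
    multiplicative. The gradings [g] and [g'] only serve to make the series finite. *)
Lemma invmx_graded h g g' A : spos g (A - 1) -> spos g' (deg0 h A - 1) ->
  nneg h A -> nneg h (invmx A) /\ deg0 h (invmx A) = invmx (deg0 h A).
Proof.
move=> /invmx_unipotent[M H] /invmx_unipotent[M' H'] nA.
have [_] := H _ (leq_maxl M M'); have [_] := H' _ (leq_maxr M M').
rewrite ![1 + (_ - 1)]addrC !subrK !opprB => -> ->.
have n1A : nneg h (1 - A) by apply: nnegD; [apply: nneg_scalar | apply: nnegN].
split; first by apply: nneg_sum => k _; apply: nneg_exp.
rewrite deg0_sum; apply: eq_bigr => k _; rewrite deg0_exp //.
by rewrite deg0D deg0N [deg0 _ 1]deg0_scalar.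
Qed.

End Unipotent.

(** * Additivity of J^-1 R_s J_21 *)

Lemma mulmx_swap_flip_legs (K : pzRingType) n L L' (X Y S : 'M[K]_(n * n)) :
  legsupp L X -> legsupp L' Y -> leg_excl L L' ->
  (forall a b c d, S (ix2 a b) (ix2 c d) != 0 -> (c = a /\ d = b) \/ (c = b /\ d = a)) ->
  X *m S *m flip Y = 0.
Proof.
move=> sX sY ex sS; apply: mx2P => a b c d; rewrite mxE big_mxtens [RHS]mxE.
rewrite big1 // => c1 _; rewrite big1 // => d1 _; rewrite mxE mulr_suml big1 // => u _.
case: (mxtens_indexP u) => a1 b1; rewrite flipE.
have [->|/sX[l1 l2]] := eqVneq (X (ix2 a b) (ix2 a1 b1)) 0; first by rewrite !mul0r.
have [->|/sY[k1 k2]] := eqVneq (Y (ix2 d1 c1) (ix2 d c)) 0; first by rewrite mulr0.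
(* [S] keeps or exchanges the two indices; either way a leg of [X] is followed by a leg of [Y]. *)
have [->|/sS[[e1 e2]|[e1 e2]]] := eqVneq (S (ix2 a1 b1) (ix2 c1 d1)) 0.
- by rewrite mulr0 mul0r.
- by rewrite e1 in k2; case: (ex _ _ _ l1 k2).
by rewrite e1 in k2; case: (ex _ _ _ l2 k2).
Qed.

Section TwistDecomposition.
Variables (K : comUnitRingType) (n : nat).
Implicit Types X Y Z : 'M[K]_(n * n).

Lemma flipM X Y : flip (X *m Y) = flip X *m flip Y.
Proof.
apply: mx2P => a b c d; rewrite flipE !mxE !big_mxtens exchange_big /=.
by do 2 (apply: eq_bigr => ? _); rewrite !flipE.
Qed.

Lemma flipD X Y : flip (X + Y) = flip X + flip Y.
Proof. by apply: mx2P => a b c d; rewrite !(flipE, mxDE). Qed.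

Lemma flip0 : flip 0 = 0 :> 'M[K]_(n * n).
Proof. by apply: mx2P => a b c d; rewrite flipE !mxE. Qed.

Lemma flip1 : flip 1%:M = 1%:M :> 'M[K]_(n * n).
Proof.
apply: mx2P => a b c d; rewrite flipE !mxE !ix2_eq.
by rewrite andbC.
Qed.

Lemma flipK : involutive (@flip K n).
Proof. by move=> X; apply: mx2P => a b c d; rewrite !flipE. Qed.

Lemma flip_sum (J : Type) (r : seq J) (P : pred J) (F : J -> 'M[K]_(n * n)) :
  flip (\sum_(j <- r | P j) F j) = \sum_(j <- r | P j) flip (F j).
Proof. exact: (big_morph _ flipD flip0). Qed.

(** Every monomial of the expanded product other than 1 ends with some [F p]. *)
Lemma prod1B_mul0 (F : nat -> 'M[K]_(n * n)) M X :
  (forall p, F p *m X = 0) -> (\prod_(0 <= p < M) (1 + F p) - 1) *m X = 0.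
Proof.
move=> FX; elim: M => [|M IHM]; first by rewrite big_nil subrr mul0mx.
rewrite big_nat_recr //= mulrDr mulr1 addrAC mulmxDl IHM add0r.
by rewrite -[_ * F M]/(_ *m F M) -mulmxA FX mulmx0.
Qed.

Lemma mul_prod1B0 (F : nat -> 'M[K]_(n * n)) M X :
  (forall p, X *m F p = 0) -> X *m (\prod_(0 <= p < M) (1 + F p) - 1) = 0.
Proof.
move=> XF; elim: M => [|M IHM]; first by rewrite big_nil subrr mulmx0.
rewrite big_nat_recr //= mulrDr mulr1 addrAC mulmxDr IHM add0r.
rewrite -[X in X * F M](subrK 1) mulrDl mul1r mulmxDr XF addr0.
by rewrite -[_ * F M]/(_ *m F M) mulmxA IHM mul0mx.
Qed.

Variables (I : finType) (A : I -> nat -> 'M[K]_(n * n)) (M : nat) (S : 'M[K]_(n * n)).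
Let J i := \prod_(0 <= p < M) (1 + A i p).
Let JT := \prod_(0 <= p < M) (1 + \sum_i A i p).
Hypothesis AA : forall i j p r, i != j -> A i p *m A j r = 0.
Hypothesis ASA : forall i j p r, i != j -> A i p *m S *m flip (A j r) = 0.
Hypothesis Junit : forall i, J i \in unitmx.

Let B i := J i - 1.
Let B' i := invmx (J i) - 1.

Let BB i j : i != j -> B i *m B j = 0.
Proof.
by move=> ij; apply: mul_prod1B0 => r; apply: prod1B_mul0 => p; apply: AA.
Qed.

Let sum_cross (X Y : I -> 'M[K]_(n * n)) Z :
  (forall i j, i != j -> X i *m Z *m Y j = 0) ->
  (\sum_i X i) *m Z *m (\sum_i Y i) = \sum_i X i *m Z *m Y i.
Proof.
move=> XY; rewrite !mulmx_suml; apply: eq_bigr => i _.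
rewrite mulmx_sumr (bigD1 i) //= big1 ?addr0 // => j ji.
by rewrite XY // eq_sym.
Qed.

Let JTE : JT = 1 + \sum_i B i.
Proof.
rewrite /JT /B /J; elim: M => [|m IHm].
  by rewrite big_nil big1 ?addr0 // => i _; rewrite big_nil subrr.
rewrite big_nat_recr //= IHm mulrDl mul1r mulrDr mulr1 -addrA; congr (_ + _).
pose Bm i := \prod_(0 <= p < m) (1 + A i p) - 1.
have -> : (\sum_i Bm i) * (\sum_i A i m) = \sum_i Bm i * A i m.
  rewrite -[LHS]/(_ *m _) -[X in X *m _]mulmx1 sum_cross.
    by apply: eq_bigr => i _; rewrite mulmx1.
  by move=> i j ij; rewrite mulmx1; apply: prod1B_mul0 => p; apply: AA.
rewrite -!big_split; apply: eq_bigr => i _ /=.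
rewrite big_nat_recr //= mulrDr mulr1.
have -> : \prod_(0 <= p < m) (1 + A i p) = Bm i + 1 by rewrite subrK.
rewrite addrK [(Bm i + 1) * _]mulrDl mul1r.
by rewrite [RHS]addrAC addrK [RHS]addrA addrC -!addrA.
Qed.

(** This factorisation of [B' i] and the next one put [B i] at its left and at its right end, so
    that vanishing mixed products pass to the inverses on either side. *)
Let BinvJ i : B' i = - (B i *m invmx (J i)).
Proof. by rewrite /B mulmxBl mulmxV // mul1mx opprB. Qed.

Let invJB i : B' i = - (invmx (J i) *m B i).
Proof. by rewrite /B mulmxBr mulVmx // mulmx1 opprB. Qed.

Let invJT : invmx JT = 1 + \sum_i B' i.
Proof.
have JB : JT *m (1 + \sum_i B' i) = 1%:M.
  rewrite JTE mulmxDl mul1mx mulmxDr mulmx1.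
  have := @sum_cross B B' 1%:M; rewrite !mulmx1 => ->; last first.
    by move=> i j ij; rewrite mulmx1 BinvJ mulmxN mulmxA BB // mul0mx oppr0.
  rewrite -addrA -[RHS]addr0; congr (_ + _); rewrite addrA -!big_split big1 //= => i _.
  rewrite mulmx1 -addrA -[X in _ + (X + _)]mulmx1 -mulmxDr [1%:M + _]addrC subrK.
  by rewrite BinvJ addNr.
have [u _] := mulmx1_unit JB.
by rewrite -[RHS](mulKmx u) JB mulmx1.
Qed.

Let BSB i j : i != j -> B' i *m S *m flip (B j) = 0.
Proof.
move=> ij; rewrite invJB !mulNmx -!mulmxA [B i *m _]prod1B_mul0 ?mulmx0 ?oppr0 // => p.
rewrite mulmxA -[A i p *m S]flipK -flipM mul_prod1B0 ?flip0 // => r.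
by apply: (can_inj flipK); rewrite flipM flipK ASA // flip0.
Qed.

Lemma twist_decomposition :
  invmx JT *m S *m flip JT - S = \sum_i (invmx (J i) *m S *m flip (J i) - S).
Proof.
rewrite invJT JTE flipD flip1 flip_sum mulmxDl mul1mx mulmxDr mulmx1 mulmxDl.
rewrite sum_cross // -[S + _ + _]addrA [S + _]addrC addrK.
rewrite mulmx_suml mulmx_sumr -!big_split; apply: eq_bigr => i _ /=.
have -> : invmx (J i) = 1%:M + B' i by rewrite addrC subrK.
have -> : J i = 1%:M + B i by rewrite addrC subrK.
rewrite [flip (1%:M + _)]flipD flip1 mulmxDl mul1mx mulmxDr mulmx1 mulmxDl.
by rewrite -[S + _ + _]addrA [S + _]addrC addrK.
Qed.

End TwistDecomposition.

(** * Matrices supported on pairs of roots *)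

Section PositionSupport.
Variables (R : realType) (n : nat) (K : pzRingType).
Implicit Types (P : posroot n -> posroot n -> Prop) (z : 'M[K]_(n * n)).

(** The alternatives are the positions of e_(-a) (x) e_b and of e_b (x) e_(-a): both occur in the
    wedges of [a_ggs], only the second in [A_pow]. *)
Definition pos_supp P z := forall x y u v, z (ix2 x y) (ix2 u v) != 0 ->
  exists a b, P a b /\
    ([/\ x = tgt a, y = src b, u = src a & v = tgt b] \/
     [/\ x = src b, y = tgt a, u = tgt b & v = src a]).

Lemma sum_neq0 (V : nmodType) (J : finType) (Q : pred J) (G : J -> V) :
  \sum_(j | Q j) G j != 0 -> exists2 j, Q j & G j != 0.
Proof.
move=> nz; have [j /andP[Qj nzj]|no] := pickP (fun j => Q j && (G j != 0)).
  by exists j.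
case/eqP: nz; rewrite big1 // => j Qj; apply/eqP.
by have := no j; rewrite Qj => /negbFE.
Qed.

Lemma pos_supp_sum (Q : rel (posroot n)) (G : posroot n -> posroot n -> 'M[K]_(n * n)) :
  (forall a b, pos_supp (fun a' b' => a' = a /\ b' = b) (G a b)) ->
  pos_supp Q (\sum_a \sum_(b | Q a b) G a b).
Proof.
move=> sG x y u v; rewrite summxE => /sum_neq0[a _].
rewrite summxE => /sum_neq0[b Qab] /sG[a' [b' [[-> ->] pos]]].
by exists a, b.
Qed.

Lemma pos_supp_tens (k : K) (a b : posroot n) :
  pos_supp (fun a' b' => a' = a /\ b' = b)
    (k *: tens K (src b) (tgt b) (tgt a) (src a)).
Proof.
move=> x y u v; rewrite mxZE tensE.
case: and4P => [[/eqP -> /eqP -> /eqP -> /eqP ->] _|]; last by rewrite mulr0 eqxx.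
by exists a, b; split=> //; right.
Qed.

Lemma pos_supp_wedge (k : K) (a b : posroot n) :
  pos_supp (fun a' b' => a' = a /\ b' = b)
    (k *: wedge (delta_mx (tgt a) (src a)) (delta_mx (src b) (tgt b))).
Proof.
move=> x y u v; rewrite mxZE mxDE mxNE !tensmxE !mxE -!natrM !mulnb.
case: andP => [[/andP[/eqP -> /eqP ->] /andP[/eqP -> /eqP ->]] _|_].
  by exists a, b; split=> //; left.
case: andP => [[/andP[/eqP -> /eqP ->] /andP[/eqP -> /eqP ->]] _|_].
  by exists a, b; split=> //; right.
by rewrite subrr mulr0 eqxx.
Qed.

Lemma pos_suppZ P (k : K) z : pos_supp P z -> pos_supp P (k *: z).
Proof.
move=> sz x y u v; rewrite mxZE => nz; apply: sz.
by apply: contraNneq nz => ->; rewrite mulr0.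
Qed.

Lemma pos_supp_imp P P' z : (forall a b, P a b -> P' a b) -> pos_supp P z -> pos_supp P' z.
Proof. by move=> PP' sz x y u v /sz[a [b [/PP' ? ?]]]; exists a, b. Qed.

Lemma pos_supp_leg (S : bd_triple R n) z :
  pos_supp (prec S) z -> legsupp (leg_of S) z.
Proof.
move=> sz x y u v /sz[a [b [/prec_supp[aS bS]]]].
by case=> -[-> -> -> ->]; split; by [apply: leg_of_neg | apply: leg_of_pos].
Qed.

Section Weights.
Variable f : 'I_n.-1 -> nat.

(** In either order of the factors the degree is [hsum f a - hsum f b], stated here without
    subtraction. *)
Let wt_pos (a b : posroot n) (x y u v : 'I_n) :
  ([/\ x = tgt a, y = src b, u = src a & v = tgt b] \/
   [/\ x = src b, y = tgt a, u = tgt b & v = src a]) ->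
  (hgt f u + hgt f v + hsum f b = hgt f x + hgt f y + hsum f a)%N.
Proof.
by case=> -[-> -> -> ->]; rewrite !hgtE; ring.
Qed.

Lemma pos_supp_nneg P z : (forall a b, P a b -> (hsum f b <= hsum f a)%N) ->
  pos_supp P z -> nneg (wt2 (hgt f)) z.
Proof.
move=> Pf sz; apply: nneg_wt2P => x y u v /sz[a [b [/Pf ba /wt_pos e]]].
by rewrite -(leq_add2r (hsum f b)) e leq_add2l.
Qed.

Lemma pos_supp_spos P z : (forall a b, P a b -> (hsum f b < hsum f a)%N) ->
  pos_supp P z -> forall x y, z x y != 0 -> (wt2 (hgt f) x < wt2 (hgt f) y)%N.
Proof.
move=> Pf sz x' y'; case: (mxtens_indexP x') => x y; case: (mxtens_indexP y') => u v.
move=> /sz[a [b [/Pf ba /wt_pos e]]].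
by rewrite !wt2E -(ltn_add2r (hsum f b)) e ltn_add2l.
Qed.

Lemma pos_supp_deg0_id P z : (forall a b, P a b -> hsum f b = hsum f a) ->
  pos_supp P z -> deg0 (wt2 (hgt f)) z = z.
Proof.
move=> Pf sz; apply: mx2P => x y u v; rewrite mxE !wt2E.
have [->|/sz[a [b [/Pf ba /wt_pos/eqP]]]] := eqVneq (z (ix2 x y) (ix2 u v)) 0.
  by rewrite if_same.
by rewrite ba eqn_add2r eq_sym => ->.
Qed.

Lemma pos_supp_deg0_eq0 P z : (forall a b, P a b -> (hsum f b < hsum f a)%N) ->
  pos_supp P z -> deg0 (wt2 (hgt f)) z = 0.
Proof.
move=> Pf sz; apply/matrixP => x y; rewrite !mxE; case: eqP => // xy.
apply/eqP; apply: contraT => /(pos_supp_spos Pf sz).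
by rewrite xy ltnn.
Qed.

End Weights.
End PositionSupport.

(** * Splitting the sums over roots; the matrices of one triple *)

Section UnionSums.
Variables (R : realType) (n : nat) (I : finType).
Variables (T : bd_triple R n) (F : I -> bd_triple R n).
Hypothesis hTF : bd_tau_orthogonal_union T F.

Lemma sum_union (V : nmodType) (Q : rel (posroot n)) (Qi : I -> rel (posroot n))
    (G : posroot n -> posroot n -> V) (Gi : I -> posroot n -> posroot n -> V) :
  (forall a b, Q a b -> supp a \subset Gamma1 T) ->
  (forall i a b, Qi i a b -> supp a \subset Gamma1 (F i)) ->
  (forall i a b, supp a \subset Gamma1 (F i) -> Q a b = Qi i a b /\ G a b = Gi i a b) ->
  \sum_a \sum_(b | Q a b) G a b = \sum_i \sum_a \sum_(b | Qi i a b) Gi i a b.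
Proof.
move=> QT QF QQ; rewrite [RHS]exchange_big; apply: eq_bigr => a _ /=.
have [/(supp_Gamma1_exists hTF)[i ai]|aT] := boolP (supp a \subset Gamma1 T).
  rewrite (bigD1 i) //= [X in _ + X]big1 ?addr0.
    by apply: eq_big => [b|b _]; have [] := QQ i a b ai.
  move=> j /eqP ji; rewrite big1 // => b /QF aj.
  by case: ji; apply: (supp_Gamma1_unique hTF) aj ai.
rewrite !big1 // => [i _|b /QT]; last by rewrite (negPf aT).
rewrite big1 // => b /QF ai; case/negP: aT.
by apply: subset_trans ai (Gamma1_union_sub hTF i).
Qed.

Lemma a_ggs_union : a_ggs T = \sum_i a_ggs (F i).
Proof.
apply: sum_union.
- by move=> a b /prec_supp[].
- by move=> i a b /prec_supp[].
by move=> i a b ai; rewrite (prec_union hTF _ ai) (sign_union hTF _ ai).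
Qed.

(** Positive powers only: the power 0 is defined on all roots, also on those belonging to no
    piece. *)
Lemma A_pow_union p : A_pow T p.+1 = \sum_i A_pow (F i) p.+1.
Proof.
rewrite /A_pow -scaler_sumr; congr (_ *: _); apply: sum_union.
- by move=> a b /tau_pow_supp[].
- by move=> i a b /tau_pow_supp[].
move=> i a b ai; rewrite (tau_pow_union hTF _ _ ai) (sign_union hTF _ ai).
by rewrite (Kexp_union hTF _ ai).
Qed.

End UnionSums.

Section TripleMatrices.
Variables (R : realType) (n : nat) (S : bd_triple R n).

Lemma pos_supp_a_ggs : pos_supp (prec S) (a_ggs S).
Proof. by apply: pos_supp_sum => a b; apply: pos_supp_wedge. Qed.

Lemma pos_supp_a_tilde : pos_supp (prec S) (a_tilde S).
Proof.
move=> x y u v; rewrite mxE => nz; apply: pos_supp_a_ggs.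
by apply: contraNneq nz => ->; rewrite fpsC0 mul0r.
Qed.

Lemma pos_supp_A_pow p : pos_supp (prec S) (A_pow S p.+1).
Proof.
apply: (@pos_supp_imp _ _ (tau_pow S p.+1)).
  by move=> a b ab; apply/asboolP; exists p.+1.
by apply: pos_suppZ; apply: pos_supp_sum => a b; apply: pos_supp_tens.
Qed.

(** The default value of [tau_depth] is harmless: the defined powers are bounded, so a maximum
    exists as soon as some positive power is defined. *)
Lemma A_pow_depth p : (tau_depth S < p)%N -> A_pow S p = 0.
Proof.
case: p => // p; rewrite /tau_depth; case: classical_sets.xgetP => [d _ [_ /= dmax] dp|none _].
  rewrite /A_pow big1 ?scaler0 // => a _; rewrite big1 // => b ab.
  have [aS _] := tau_pow_supp ab.
  have : (p.+1 <= d)%N by apply: dmax; exists a, b; rewrite mem_tilde.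
  by rewrite leqNgt dp.
rewrite /A_pow big1 ?scaler0 // => a _; rewrite big1 // => b ab.
have [aS _] := tau_pow_supp ab.
pose defd p := `[< exists a b, a \in tilde R (Gamma1 S) /\ tau_pow S p a b >].
have [N Nmax] := tau_pow_bounded S.
have ex : exists p, defd p.
  by exists p.+1; apply/asboolP; exists a, b; rewrite mem_tilde.
have bd r : defd r -> (r <= N)%N by move=> /asboolP[a' [b' [_ /Nmax]]].
have [d /asboolP dd dmax] := ex_maxnP ex bd.
by case: (none d); split=> // r rr; apply: dmax; apply/asboolP.
Qed.

(** Factors beyond the depth equal 1, so the twists of a union and of its pieces, whose depths may
    differ, can be written over a common range. *)
Lemma J_twistE N : (tau_depth S <= N)%N ->
  J_twist S = \prod_(0 <= p < N) (1 + A_pow S p.+1).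
Proof.
move=> dN; rewrite /J_twist big_add1 /= [RHS](big_cat_nat (n := tau_depth S)) //=.
rewrite [X in _ * X]big_nat [X in _ * X]big1 ?mulr1 // => p /andP[dp _].
by rewrite A_pow_depth ?addr0.
Qed.

Lemma prec_hsum_lt (f : 'I_n.-1 -> nat) a b :
  {in Gamma1 S, forall k, f k = 1 + f (tau S k)}%N -> prec S a b ->
  (hsum f b < hsum f a)%N.
Proof.
move=> fP /asboolP[p [p0 /(hsum_tau_pow_le fP)]]; apply: leq_trans.
by rewrite mul1n -add1n leq_add2r.
Qed.

Lemma prec_hsum_eq (f : 'I_n.-1 -> nat) a b :
  {in Gamma1 S, forall k, f k = 0 + f (tau S k)}%N -> prec S a b ->
  hsum f b = hsum f a.
Proof. by move=> fP /asboolP[p [p0 ab]]; rewrite (hsum_tau_pow_eq fP _ ab). Qed.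

Lemma J_twist_unipotent : exists h, spos h (J_twist S - 1).
Proof.
have [f fP] := potential_exists S (fun=> 1%N).
exists (wt2 (hgt f)); rewrite (J_twistE (leqnn _)).
apply: spos_prod1B => p.
apply: pos_supp_spos (@pos_supp_A_pow p).
by move=> a b; apply: prec_hsum_lt.
Qed.

End TripleMatrices.

Section StandardSupport.
Variables (R : realType) (n : nat).

Lemma R_s_supp (a b c d : 'I_n) : R_s R n (ix2 a b) (ix2 c d) != 0 ->
  (c = a /\ d = b) \/ (c = b /\ d = a).
Proof.
rewrite R_sE; have [/andP[/eqP -> /eqP ->] _|_] := boolP ((a == c) && (b == d)).
  by left.
have [/andP[/eqP -> /eqP ->] _|_] := boolP ((a == d) && (b == c)); first by right.
by rewrite !mulr0 addr0 eqxx.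
Qed.

Lemma nneg_R_s (h : 'I_n -> nat) : nneg (wt2 h) (R_s R n).
Proof.
by apply: nneg_wt2P => a b c d /R_s_supp[[-> ->]|[-> ->]] //; rewrite addnC.
Qed.

Lemma deg0_R_s (h : 'I_n -> nat) : deg0 (wt2 h) (R_s R n) = R_s R n.
Proof.
apply: mx2P => a b c d; rewrite mxE !wt2E.
have [->|/R_s_supp[[-> ->]|[-> ->]]] := eqVneq (R_s R n (ix2 a b) (ix2 c d)) 0.
- by rewrite if_same.
- by rewrite eqxx.
by rewrite addnC eqxx.
Qed.

End StandardSupport.

(** * Decomposition of both R-matrices along the union *)

Section UnionDecomposition.
Variables (R : realType) (n : nat) (I : finType).
Variables (T : bd_triple R n) (F : I -> bd_triple R n).
Hypothesis hTF : bd_tau_orthogonal_union T F.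
Local Notation C := R[i].
Local Notation A := (fps C).

Lemma pos_supp_disjoint (K : pzRingType) i j (z w : 'M[K]_(n * n)) : i != j ->
  pos_supp (prec (F i)) z -> pos_supp (prec (F j)) w -> leg_disjoint z w.
Proof.
move=> ij sz sw; exists (leg_of (F i)), (leg_of (F j)).
split; [exact: pos_supp_leg|exact: pos_supp_leg| |].
  exact: (leg_excl_union hTF).
by apply: (leg_excl_union hTF); rewrite eq_sym.
Qed.

(** The grading by [hgt f] then puts the terms of piece [i] in degree 0 and those of the other
    pieces in positive degree. *)
Definition separates i (f : 'I_n.-1 -> nat) : Prop :=
  {in Gamma1 (F i), forall k, f k = 0 + f (tau (F i) k)}%N /\
  forall j, j != i -> {in Gamma1 (F j), forall k, f k = 1 + f (tau (F j) k)}%N.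

Lemma separates_exists i : exists f, separates i f.
Proof.
have [f fP] := potential_exists T (fun k => k \notin Gamma1 (F i)).
exists f; split=> [k ki|j ji k kj].
  by rewrite fP ?(subsetP (Gamma1_union_sub hTF i)) // ki (tau_union hTF ki).
rewrite fP ?(subsetP (Gamma1_union_sub hTF j)) // (tau_union hTF kj).
have [ki|//] := boolP (k \in Gamma1 (F i)).
by case/eqP: ji; apply: (Gamma1_unique hTF) kj ki.
Qed.

Section Separated.
Variables (i : I) (f : 'I_n.-1 -> nat).
Hypothesis fi : separates i f.
Local Notation h := (wt2 (hgt f)).

Let prec_le j a b : prec (F j) a b -> (hsum f b <= hsum f a)%N.
Proof.
have [-> ab|ji ab] := eqVneq j i; first by rewrite (prec_hsum_eq fi.1 ab).
by apply/ltnW/(prec_hsum_lt (fi.2 j ji) ab).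
Qed.

Lemma nneg_prec (K : pzRingType) j (z : 'M[K]_(n * n)) :
  pos_supp (prec (F j)) z -> nneg h z.
Proof. by move=> sz; apply: pos_supp_nneg sz; apply: prec_le. Qed.

Lemma deg0_prec (K : pzRingType) j (z : 'M[K]_(n * n)) :
  pos_supp (prec (F j)) z -> deg0 h z = if j == i then z else 0.
Proof.
move=> sz; have [ji|ji] := eqVneq j i.
  apply: pos_supp_deg0_id sz => a b; rewrite ji.
  by move=> ab; rewrite (prec_hsum_eq fi.1 ab).
apply: pos_supp_deg0_eq0 sz => a b ab.
exact: prec_hsum_lt (fi.2 j ji) ab.
Qed.

Lemma nneg_prec_sum (K : pzRingType) (z : I -> 'M[K]_(n * n)) :
  (forall j, pos_supp (prec (F j)) (z j)) -> nneg h (\sum_j z j).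
Proof. by move=> sz; apply: nneg_sum => j _; apply: nneg_prec (sz j). Qed.

Lemma deg0_prec_sum (K : pzRingType) (z : I -> 'M[K]_(n * n)) :
  (forall j, pos_supp (prec (F j)) (z j)) -> deg0 h (\sum_j z j) = z i.
Proof.
move=> sz; rewrite deg0_sum (bigD1 i) //= big1 ?addr0 => [|j ji].
  by rewrite (deg0_prec (sz i)) eqxx.
by rewrite (deg0_prec (sz j)) (negPf ji).
Qed.

Lemma nneg_r_s : nneg h (r_s R n).
Proof.
have nt (i' j k l : 'I_n) : (hgt f i' + hgt f k = hgt f j + hgt f l)%N ->
    nneg h (tens C i' j k l).
  move=> e; apply: nneg_wt2P => a b c d; rewrite tensE.
  case: and4P => [[/eqP -> /eqP -> /eqP -> /eqP ->] _|]; last by rewrite eqxx.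
  by rewrite e.
apply: nnegD; last by apply: nneg_sum => a _; apply: nt; rewrite addnC.
by apply: nnegZ; apply: nneg_sum => a _; apply: nt.
Qed.

Lemma deg0_eps_ggs j : j != i -> deg0 h (eps_ggs (F j)) = 0.
Proof.
move=> ji; have sa := @pos_supp_a_ggs _ _ (F j).
have na := nneg_prec sa; have da := deg0_prec sa; rewrite (negPf ji) in da.
have nr := nneg_r_s.
rewrite !deg0D !deg0M // da !(mul0mx, mulmx0) !addr0 //.
Qed.

End Separated.

Lemma eps_ggs_union : eps_ggs T = \sum_i eps_ggs (F i).
Proof.
rewrite /eps_ggs (a_ggs_union hTF) mulmx_suml mulmx_sumr mulmx_suml !big_split /=.
congr (_ + _); apply: eq_bigr => i _.
rewrite mulmx_sumr (bigD1 i) //= big1 ?addr0 // => j ji.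
apply: mulmx_legs (pos_supp_leg (@pos_supp_a_ggs _ _ _))
  (pos_supp_leg (@pos_supp_a_ggs _ _ _)) _.
by apply: (leg_excl_union hTF); rewrite eq_sym.
Qed.

(** At a position where a(F i) is nonzero, the grading separating [i] has degree 0. For [j] other
    than [i] the degree 0 parts of a(F j) and epsilon(F j) are zero, the latter because each term of
    epsilon contains a factor a. So coefficient and exponent at this position are those of [F i]
    alone. *)
Lemma a_tilde_union : a_tilde T = \sum_i a_tilde (F i).
Proof.
apply/matrixP => u v; rewrite [RHS]summxE [LHS]mxE.
under eq_bigr do rewrite mxE.
have [i ai|a0] := pickP (fun i => a_ggs (F i) u v != 0); last first.
  rewrite (a_ggs_union hTF) summxE big1 => [|i _]; last first.
    by apply/eqP; have /negbFE := a0 i.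
  rewrite fpsC0 mul0r big1 // => i _.
  by have /negbFE/eqP -> := a0 i; rewrite fpsC0 mul0r.
have [f fi] := separates_exists i.
have /matrixP/(_ u v) := deg0_prec fi (@pos_supp_a_ggs _ _ (F i)).
rewrite eqxx mxE; case: eqP => [uv _|_ a0]; last by rewrite -a0 eqxx in ai.
have aj j : j != i -> a_ggs (F j) u v = 0.
  move=> ji; have /matrixP/(_ u v) := deg0_prec fi (@pos_supp_a_ggs _ _ (F j)).
  by rewrite (negPf ji) !mxE uv eqxx.
have ej j : j != i -> eps_ggs (F j) u v = 0.
  move=> ji; have /matrixP/(_ u v) := deg0_eps_ggs fi ji.
  by rewrite !mxE uv eqxx.
rewrite (a_ggs_union hTF) eps_ggs_union !summxE.
rewrite [\sum_j a_ggs _ _ _](bigD1 i) //= [X in _ + X]big1 ?addr0 //.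
rewrite [\sum_j eps_ggs _ _ _](bigD1 i) //= [X in _ + X]big1 ?addr0 //.
by rewrite [RHS](bigD1 i) //= [X in _ + X]big1 ?addr0 // => j /aj ->; rewrite fpsC0 mul0r.
Qed.

Definition ggs_part i : 'M[A]_(n * n) := (q R - qV R) *: a_tilde (F i).

Lemma pos_supp_ggs_part i : pos_supp (prec (F i)) (ggs_part i).
Proof. by apply: pos_suppZ; apply: pos_supp_a_tilde. Qed.

Lemma Rbar_GGS_union : Rbar_GGS T = R_s R n + \sum_i ggs_part i.
Proof. by rewrite /Rbar_GGS a_tilde_union scaler_sumr. Qed.

Lemma nneg_Rbar_GGS i f : separates i f -> nneg (wt2 (hgt f)) (Rbar_GGS T).
Proof.
move=> fi; rewrite Rbar_GGS_union; apply: nnegD; first exact: nneg_R_s.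
exact: (nneg_prec_sum fi) pos_supp_ggs_part.
Qed.

Lemma deg0_Rbar_GGS i f : separates i f ->
  deg0 (wt2 (hgt f)) (Rbar_GGS T) = Rbar_GGS (F i).
Proof.
move=> fi; rewrite Rbar_GGS_union deg0D deg0_R_s.
by rewrite (deg0_prec_sum fi pos_supp_ggs_part).
Qed.

Lemma common_depth : exists N, [/\ (tau_depth T <= N)%N & forall i, (tau_depth (F i) <= N)%N].
Proof.
exists (maxn (tau_depth T) (\max_i tau_depth (F i))); split; first exact: leq_maxl.
by move=> i; apply: leq_trans (leq_maxr _ _); apply: leq_bigmax.
Qed.

Section JGraded.
Variables (i : I) (f : 'I_n.-1 -> nat).
Hypothesis fi : separates i f.
Local Notation h := (wt2 (hgt f)).

Let nJ p : nneg h (1 + A_pow T p.+1).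
Proof.
apply: nnegD; first exact: nneg_scalar.
by rewrite (A_pow_union hTF); apply: (nneg_prec_sum fi) => j; apply: pos_supp_A_pow.
Qed.

Lemma nneg_J_twist : nneg h (J_twist T).
Proof. by rewrite (J_twistE (leqnn _)); apply: nneg_prod. Qed.

Lemma deg0_J_twist : deg0 h (J_twist T) = J_twist (F i).
Proof.
have [N [dT dF]] := common_depth; rewrite (J_twistE dT) (J_twistE (dF i)) deg0_prod //.
apply: eq_bigr => p _; rewrite deg0D [deg0 _ 1]deg0_scalar (A_pow_union hTF).
by rewrite (deg0_prec_sum fi (z := fun j => A_pow (F j) p.+1)) // => j; apply: pos_supp_A_pow.
Qed.

Lemma invmx_J_twist_graded :
  nneg h (invmx (J_twist T)) /\ deg0 h (invmx (J_twist T)) = invmx (J_twist (F i)).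
Proof.
have [g sT] := J_twist_unipotent T; have [g' sF] := J_twist_unipotent (F i).
by rewrite -deg0_J_twist in sF *; apply: invmx_graded sT sF nneg_J_twist.
Qed.

Lemma deg0_Rbar_J : deg0 h (Rbar_J T) = Rbar_J (F i).
Proof.
have [nI dI] := invmx_J_twist_graded; have nR := @nneg_R_s R n (hgt f).
rewrite /Rbar_J deg0M; last by apply/nneg_flip/nneg_J_twist.
  by rewrite deg0M // dI deg0_R_s deg0_flip deg0_J_twist.
exact: nnegM.
Qed.

End JGraded.

Lemma Rbar_J_union :
  Rbar_J T - R_s R n = \sum_i (Rbar_J (F i) - R_s R n).
Proof.
have [N [dT dF]] := common_depth.
rewrite /Rbar_J (J_twistE dT).
have -> : \prod_(0 <= p < N) (1 + A_pow T p.+1) =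
    \prod_(0 <= p < N) (1 + \sum_j A_pow (F j) p.+1).
  by apply: eq_bigr => p _; rewrite (A_pow_union hTF).
have -> : \sum_i (invmx (J_twist (F i)) *m R_s R n *m flip (J_twist (F i)) - R_s R n) =
    \sum_i (invmx (\prod_(0 <= p < N) (1 + A_pow (F i) p.+1)) *m R_s R n
            *m flip (\prod_(0 <= p < N) (1 + A_pow (F i) p.+1)) - R_s R n).
  by apply: eq_bigr => i _; rewrite (J_twistE (dF i)).
have legA j p : legsupp (leg_of (F j)) (A_pow (F j) p.+1).
  by apply: pos_supp_leg; apply: pos_supp_A_pow.
apply: (twist_decomposition (A := fun j p => A_pow (F j) p.+1)).
- move=> i j p r ij; apply: mulmx_legs (legA i p) (legA j r) _.
  exact: (leg_excl_union hTF).
- move=> i j p r ij; have ex := leg_excl_union hTF ij.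
  exact: mulmx_swap_flip_legs (legA i p) (legA j r) ex (@R_s_supp R n).
move=> i; rewrite -(J_twistE (dF i)).
by have [g] := J_twist_unipotent (F i); apply: unipotent_unitmx.
Qed.

End UnionDecomposition.

(** * Solving the linear system for r0 *)

Section CartanSolutions.
Variables (R : realType) (n : nat) (S : bd_triple R n).
Local Notation C := R[i].
Implicit Types (k l : 'I_n.-1) (u v w : 'rV[C]_n).

Lemma dotDl u v w : dot (u + v) w = dot u w + dot v w.
Proof. by rewrite /dot -big_split; apply: eq_bigr => j _; rewrite mxE mulrDl. Qed.
Lemma dotZl (c : C) u w : dot (c *: u) w = c * dot u w.
Proof. by rewrite /dot mulr_sumr; apply: eq_bigr => j _; rewrite mxE mulrA. Qed.
Lemma dotC u v : dot u v = dot v u.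
Proof. by apply: eq_bigr => j _; rewrite mulrC. Qed.
Lemma dotBl u v w : dot (u - v) w = dot u w - dot v w.
Proof. by rewrite -scaleN1r dotDl dotZl mulN1r. Qed.
Lemma dot_e (m : 'I_n) w : dot (e R n m) w = w 0 m.
Proof.
rewrite /dot (bigD1 m) //= mxE eqxx mul1r big1 ?addr0 // => j jm.
by rewrite mxE val_eqE (negPf jm) mul0r.
Qed.
Lemma dot_suml (J : Type) (r : seq J) (P : pred J) (G : J -> 'rV[C]_n) w :
  dot (\sum_(j <- r | P j) G j) w = \sum_(j <- r | P j) dot (G j) w.
Proof.
rewrite /dot exchange_big; apply: eq_bigr => j _.
by rewrite summxE mulr_suml.
Qed.

Lemma dot_simple_root_hgt (f : 'I_n.-1 -> nat) k :
  dot (simple_root R k) (\row_j (hgt f j)%:R) = (f k)%:R.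
Proof.
have kn := ord_pred_succ_lt k.
rewrite dotBl (dot_e (Ordinal (ltnW kn))) (dot_e (Ordinal kn)) !mxE /hgt.
rewrite [X in X%:R - _](bigD1 k) //= natrD.
rewrite [X in _ + X%:R](eq_bigl (fun l : 'I_n.-1 => (k < l)%N)) ?addrK // => l.
by rewrite ltn_neqAle andbC eq_sym.
Qed.

Definition root_diff k : 'rV[C]_n :=
  if k \in Gamma1 S then simple_root R k - simple_root R (tau S k) else 0.
Definition root_mean k : 'rV[C]_n :=
  if k \in Gamma1 S then 2^-1 *: (simple_root R k + simple_root R (tau S k)) else 0.

(** Since tau is an isometry, the products (alpha, beta) and (tau alpha, tau beta) cancel, and the
    rest, half of (tau alpha, beta) - (alpha, tau beta), is antisymmetric. *)
Lemma root_mean_diff k l :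
  dot (root_mean k) (root_diff l) = - dot (root_mean l) (root_diff k).
Proof.
have dot0 w : dot 0 w = 0 by rewrite -[0]addr0 -(scale0r (0 : 'rV[C]_n)) dotDl dotZl mul0r addr0.
rewrite /root_mean /root_diff; case: ifP => kS; case: ifP => lS;
  rewrite ?dot0 ?[dot _ 0]dotC ?dot0 ?oppr0 //.
have := bd_isom kS lS; move: (simple_root R k) (simple_root R l).
move: (simple_root R (tau S k)) (simple_root R (tau S l)) => a' b' a b ab.
rewrite !dotZl !dotDl ![dot _ (_ - _)]dotC !dotBl (dotC b a) (dotC b' a) (dotC b a').
by rewrite (dotC b' a') ab; ring.
Qed.

(* The differences alpha - tau(alpha) are independent, with dual family [W]; the
   compatibility condition is the antisymmetry [root_mean_diff]. *)
Lemma r0_solution_exists : exists r0, r0_solution S r0.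
Proof.
(* With cost 1 at [k] only, the weights [hgt (f k)] pair to 1 with alpha_k - tau(alpha_k) for [k] in
   [Gamma1], and to 0 with the other differences. *)
have /fin_all_exists[f fP] (k : 'I_n.-1) : exists f : 'I_n.-1 -> nat,
    {in Gamma1 S, forall m, f m = (m == k) + f (tau S m)}%N.
  exact: potential_exists.
pose U : 'M[C]_(n.-1, n) := \matrix_(k, j) root_diff k 0 j.
pose V : 'M[C]_(n.-1, n) := \matrix_(k, j) root_mean k 0 j.
pose W : 'M[C]_(n, n.-1) := \matrix_(j, k) if k \in Gamma1 S then (hgt (f k) j)%:R else 0.
pose E : 'M[C]_(n.-1) := diag_mx (\row_k (k \in Gamma1 S)%:R).
have UW : U *m W = E.
  apply/matrixP => k l; rewrite !mxE.
  have [lS|lS] := boolP (l \in Gamma1 S); last first.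
    rewrite big1 => [|j _]; last by rewrite !mxE (negPf lS) mulr0.
    by case: (k =P l) => [->|//]; rewrite (negPf lS).
  transitivity (dot (root_diff k) (\row_j (hgt (f l) j)%:R)).
    by apply: eq_bigr => j _; rewrite !mxE lS.
  rewrite /root_diff; case: ifP => kS; last first.
    by rewrite /dot big1 ?mul0rn // => j _; rewrite mxE mul0r.
  rewrite dotBl !dot_simple_root_hgt (fP l k kS) natrD addrK.
  by case: (k == l).
have EV : E *m V = V.
  apply/matrixP => k j; rewrite mul_diag_mx !mxE /root_mean.
  by case: ifP => _; rewrite ?mul1r // mxE mulr0.
have [M ME] : exists M, M = V *m U^T by exists (V *m U^T).
have EM : E *m M = M by rewrite ME mulmxA EV.
have MT : M^T = - M.
  apply/matrixP => k l; rewrite ME !mxE.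
  transitivity (dot (root_mean l) (root_diff k)).
    by apply: eq_bigr => j _; rewrite !mxE.
  by rewrite root_mean_diff; congr (- _); apply: eq_bigr => j _; rewrite !mxE.
(* [W V] solves [U r = V]. Subtracting its transpose makes it antisymmetric but adds [M W^T] to the
   right side, since [U V^T = M^T = - M]; the last term, antisymmetric as [M] is, removes this. *)
pose r := W *m V - V^T *m W^T - W *m M *m W^T.
have Ur : U *m r = V.
  rewrite !mulmxDr !mulmxN !mulmxA UW EV EM.
  have -> : U *m V^T = M^T by rewrite ME trmx_mul trmxK.
  by rewrite MT mulNmx opprK addrK.
have rT : r^T = - r.
  have trB (X Y : 'M[C]_n) : (X - Y)^T = X^T - Y^T.
    by apply/matrixP => a b; rewrite !mxE.
  rewrite !trB !trmx_mul !trmxK MT mulNmx mulmxN mulmxA.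
  by rewrite opprK !opprB addrC.
have r_anti a b : r b a = - r a b by move/matrixP/(_ a b): rT; rewrite [LHS]mxE [RHS]mxE.
exists (diag2 (fun a b => r a b)); split; first exact: diag2_in_wedge_h.
move=> k kS; rewrite contract_diag2 contract_P0mx -linearZ /=; congr diag_mx.
apply/rowP => j; have /matrixP/(_ k j) := Ur.
rewrite [LHS]mxE [RHS]mxE /root_mean kS => <-; rewrite mxE.
by apply: eq_bigr => i _; rewrite [U k i]mxE /root_diff kS.
Qed.

(** For fixed [x] the column of [s] is a linear form vanishing on all alpha - tau(alpha), hence
    constant along the iterates of tau. *)
Lemma prec_cartan (s : 'I_n -> 'I_n -> C) :
  (forall a b, s b a = - s a b) ->
  {in Gamma1 S, forall k, contract (simple_root R k - simple_root R (tau S k)) (diag2 s) = 0} ->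
  forall a b, prec S a b -> forall x,
    s (src a) x - s (tgt a) x = s (src b) x - s (tgt b) x.
Proof.
move=> s_anti sS a b /asboolP[p [_ pab]] x.
pose t : 'rV[C]_n := \row_i s i x.
have rootE c : dot (root_vec R c) t = s (src c) x - s (tgt c) x.
  by rewrite dotBl !dot_e !mxE.
rewrite -!rootE; elim: p a pab => [|p IHp] a /=; first by move=> /eqP ->.
case/existsP=> c /andP[ac /IHp <-]; have [/subsetP aS _] := supp_tau_step ac.
case/andP: ac => _ /eqP ->; rewrite root_vec_sum /tau_vec !dot_suml.
apply: eq_big => [k|k ka]; first by rewrite inE.
apply/subr0_eq; rewrite -dotBl.
have /matrixP/(_ x x) := sS k (aS k ka); rewrite contract_diag2 !mxE eqxx mulr1n => <-.
by apply: eq_bigr => i _; rewrite !mxE.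
Qed.

End CartanSolutions.

Lemma mulmx_conj_inj (K : comUnitRingType) N (D D' X Y : 'M[K]_N) :
  D *m D' = 1%:M -> D *m X *m D = D *m Y *m D -> X = Y.
Proof.
move=> DD' /(congr1 (fun Z => D' *m Z *m D')).
by rewrite !mulmxA (mulmx1C DD') !mul1mx -!mulmxA DD' !mulmx1.
Qed.

Lemma mulmx_conj_comp (K : pzRingType) N (D D' X : 'M[K]_N) :
  D *m (D' *m X *m D') *m D = (D *m D') *m X *m (D' *m D).
Proof. by rewrite !mulmxA. Qed.

Lemma conj_mxD (K : pzRingType) N (D X Y : 'M[K]_N) :
  D *m (X + Y) *m D = D *m X *m D + D *m Y *m D.
Proof. by rewrite mulmxDr mulmxDl. Qed.

Lemma conj_mx_sum (K : pzRingType) N (J : finType) (D : 'M[K]_N) (G : J -> 'M[K]_N) :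
  D *m (\sum_j G j) *m D = \sum_j D *m G j *m D.
Proof. by rewrite mulmx_sumr mulmx_suml. Qed.

(** * Dependence on the choice of r0 *)

Section TwistedMatrices.
Variables (R : realType) (n : nat).
Local Notation C := R[i].
Local Notation A := (fps C).
Implicit Types (s : 'I_n -> 'I_n -> C) (S : bd_triple R n) (r : 'M[C]_(n * n)).

Definition qdiag s : 'M[A]_(n * n) := diag2 (fun a b => qpow (s a b)).

Lemma qdiagE s : qpow_mx (diag2 s) = qdiag s.
Proof. exact: qpow_mx_diag2. Qed.

Lemma R_GGSE S s : R_GGS S (diag2 s) = qdiag s *m Rbar_GGS S *m qdiag s.
Proof. by rewrite /R_GGS qdiagE. Qed.

Lemma R_JE S s : R_J S (diag2 s) = qdiag s *m Rbar_J S *m qdiag s.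
Proof. by rewrite /R_J qdiagE. Qed.

Lemma qdiagD s s' : qdiag s *m qdiag s' = qdiag (fun a b => s a b + s' a b).
Proof.
rewrite /qdiag diag2M; congr diag_mx; apply/rowP => x; rewrite !mxE.
by rewrite qpowD.
Qed.

Lemma qdiagNK s : qdiag s *m qdiag (fun a b => - s a b) = 1%:M.
Proof.
rewrite qdiagD; apply/matrixP => x y; rewrite !mxE subrr qpow0.
by [].
Qed.

Lemma qdiag_inj s (X Y : 'M[A]_(n * n)) :
  qdiag s *m X *m qdiag s = qdiag s *m Y *m qdiag s -> X = Y.
Proof. exact: (mulmx_conj_inj (qdiagNK s)). Qed.

(** [R_s] keeps or exchanges the two indices, and at e_(-alpha) (x) e_beta the total weight changes
    by the difference of the values of [s] on alpha and beta, which is zero by assumption. *)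
Lemma Rbar_GGS_supp S (s : 'I_n -> 'I_n -> C) :
  (forall a b, prec S a b -> forall x,
    s (src a) x - s (tgt a) x = s (src b) x - s (tgt b) x) ->
  weight_compat s (Rbar_GGS S).
Proof.
move=> sS a b c d; rewrite /Rbar_GGS mxDE.
have [->|/R_s_supp[[-> ->]|[-> ->]] _ x //] := eqVneq (R_s R n (ix2 a b) (ix2 c d)) 0;
  last by rewrite addrC.
rewrite add0r => /(pos_suppZ (@pos_supp_a_tilde _ _ S))[a' [b' [/sS ab]]].
by case=> -[-> -> -> ->] x; apply/esym/subr0_eq; have /eqP := ab x;
  rewrite -subr_eq0 => /eqP <-; ring.
Qed.

(* Two solutions of the system for r0 differ by a Cartan element of weight zero on every
   term of Rbar_GGS, so that they give twist-equivalent R-matrices. *)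
Lemma GGS_change_r0 S r r' : r0_solution S r -> r0_solution S r' ->
  (QYBE (R_GGS S r) -> QYBE (R_GGS S r')) /\ (Hecke (R_GGS S r) -> Hecke (R_GGS S r')).
Proof.
move=> [/in_wedge_hE[s -> s_anti] rS] [/in_wedge_hE[s' -> s_anti'] r'S].
pose u a b := s' a b - s a b.
have u_anti a b : u b a = - u a b by rewrite /u s_anti s_anti' opprB opprK addrC.
have uS : {in Gamma1 S, forall k,
    contract (simple_root R k - simple_root R (tau S k)) (diag2 u) = 0}.
  move=> k kS; have := r'S k kS; rewrite -(rS k kS) !contract_diag2 => e.
  rewrite -[RHS](subrr (diag_mx (\row_l \sum_i
     (simple_root R k - simple_root R (tau S k)) 0 i * s i l))) -{1}e -linearB /=.
  congr diag_mx; apply/rowP => l; rewrite !mxE -sumrB; apply: eq_bigr => i _.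
  by rewrite mulrBr.
have wc := Rbar_GGS_supp (prec_cartan u_anti uS).
have Us : qdiag u *m qdiag s = qdiag s'.
  by rewrite qdiagD /qdiag; congr diag2; do 2 apply/funext => ?; rewrite subrK.
have sU : qdiag s *m qdiag u = qdiag s'.
  by rewrite qdiagD /qdiag; congr diag2; do 2 apply/funext => ?; rewrite addrC subrK.
have -> : R_GGS S (diag2 s') = qdiag u *m R_GGS S (diag2 s) *m qdiag u.
  by rewrite !R_GGSE; move: (Rbar_GGS S) => X; rewrite mulmx_conj_comp Us sU.
split=> H.
  apply: (QYBE_twist (@qpowD R) u_anti) H => a b c d.
  rewrite R_GGSE diag2E => nz; apply: wc.
  by apply: contraNneq nz => ->; rewrite mulr0 mul0r.
exact: (hecke_defect_twist (@qpowD R) (qpow0 R) u_anti).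
Qed.

End TwistedMatrices.

(** * Restriction to a piece and recombination for a fixed r0 *)

Section FixedCartanPart.
Variables (R : realType) (n : nat) (I : finType).
Variables (T : bd_triple R n) (F : I -> bd_triple R n).
Hypothesis hTF : bd_tau_orthogonal_union T F.
Local Notation A := (fps R[i]).

Lemma r0_solution_union r i : r0_solution T r -> r0_solution (F i) r.
Proof.
move=> [wr rT]; split=> // k ki.
by have := rT k (subsetP (Gamma1_union_sub hTF i) k ki); rewrite (tau_union hTF ki).
Qed.

Lemma deg0_conj_diag2 (K : comNzRingType) h t (z : 'M[K]_(n * n)) : nneg h z ->
  nneg h (diag2 t *m z *m diag2 t) /\
  deg0 h (diag2 t *m z *m diag2 t) = diag2 t *m deg0 h z *m diag2 t.
Proof.
move=> nz; have nd := @nneg_diag2 K n h t.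
have ndz := nnegM nd nz.
by split; [exact: nnegM | rewrite !deg0M // deg0_diag2].
Qed.

Section OneCartanPart.
Variable s : 'I_n -> 'I_n -> R[i].

Lemma GGS_restrict i :
  (QYBE (R_GGS T (diag2 s)) -> QYBE (R_GGS (F i) (diag2 s))) /\
  (Hecke (R_GGS T (diag2 s)) -> Hecke (R_GGS (F i) (diag2 s))).
Proof.
have [f fi] := separates_exists hTF i.
have [nR dR] : nneg (wt2 (hgt f)) (R_GGS T (diag2 s)) /\
    deg0 (wt2 (hgt f)) (R_GGS T (diag2 s)) = R_GGS (F i) (diag2 s).
  rewrite (R_GGSE T s) (R_GGSE (F i) s) -(deg0_Rbar_GGS hTF fi).
  exact: deg0_conj_diag2 (nneg_Rbar_GGS hTF fi).
rewrite -dR.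
split=> [/(QYBE_deg0 nR) //|].
by rewrite /Hecke => H; rewrite -deg0_Hecke // H deg0_0.
Qed.

(** Cancelling q^r0 leaves an equality that no longer involves r0; it therefore serves for every
    solution of the system for [F i]. *)
Lemma R_J_restrict i : R_J T (diag2 s) = R_GGS T (diag2 s) ->
  Rbar_J (F i) = Rbar_GGS (F i).
Proof.
have [f fi] := separates_exists hTF i.
rewrite R_JE R_GGSE => /qdiag_inj/(congr1 (deg0 (wt2 (hgt f)))).
by rewrite (deg0_Rbar_J hTF fi) (deg0_Rbar_GGS hTF fi).
Qed.

Lemma R_J_combine : (forall i, R_J (F i) (diag2 s) = R_GGS (F i) (diag2 s)) ->
  R_J T (diag2 s) = R_GGS T (diag2 s).
Proof.
move=> JG; have e : Rbar_J T = R_s R n + \sum_i (Rbar_J (F i) - R_s R n).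
  by rewrite -(Rbar_J_union hTF) addrC subrK.
rewrite R_JE R_GGSE (Rbar_GGS_union hTF) e.
suff -> : \sum_i (Rbar_J (F i) - R_s R n) = \sum_i ggs_part F i by [].
apply: eq_bigr => i _; have := JG i; rewrite (R_JE (F i) s) (R_GGSE (F i) s).
by move=> /qdiag_inj ->; rewrite /Rbar_GGS addrC addKr.
Qed.

Hypothesis s_anti : forall a b, s b a = - s a b.

Local Notation Q := (qdiag s).
Let c i := Q *m ggs_part F i *m Q.

Let c_disjoint i j : i != j -> leg_disjoint (c i) (c j).
Proof.
move=> ij; have [L [L' [sL sL' e e']]] :=
  pos_supp_disjoint hTF ij (@pos_supp_ggs_part _ _ _ F i) (@pos_supp_ggs_part _ _ _ F j).
exists L, L'; split; [| |exact: e|exact: e'].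
  exact: (@legsupp_diag2 _ _ L (fun a b => qpow (s a b)) _ sL).
exact: (@legsupp_diag2 _ _ L' (fun a b => qpow (s a b)) _ sL').
Qed.

Let R_GGS_union : R_GGS T (diag2 s) = Q *m R_s R n *m Q + \sum_i c i.
Proof.
rewrite R_GGSE (Rbar_GGS_union hTF).
apply: etrans (conj_mxD Q (R_s R n) (\sum_i ggs_part F i)) _.
exact: congr1 (conj_mx_sum Q (ggs_part F)).
Qed.

Let R_GGS_part i : R_GGS (F i) (diag2 s) = Q *m R_s R n *m Q + c i.
Proof. exact: etrans (R_GGSE (F i) s) (conj_mxD Q (R_s R n) (ggs_part F i)). Qed.

Lemma GGS_combine :
  ((forall i, QYBE (R_GGS (F i) (diag2 s))) -> QYBE (R_GGS T (diag2 s))) /\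
  ((forall i, Hecke (R_GGS (F i) (diag2 s))) -> Hecke (R_GGS T (diag2 s))).
Proof.
have [yb he] := standard_twisted s_anti.
split=> H; rewrite R_GGS_union.
  by apply: (QYBE_sum c_disjoint yb) => i; rewrite -R_GGS_part; apply: H.
by apply: (hecke_sum c_disjoint he) => i; rewrite -R_GGS_part; apply: H.
Qed.

End OneCartanPart.
End FixedCartanPart.

Theorem theorem1p7 (R : realType) (n : nat) (hn : (2 <= n)%N)
    (I : finType) (T : bd_triple R n) (F : I -> bd_triple R n)
    (hTF : bd_tau_orthogonal_union T F) :
  (GGS_conjecture T <-> forall i : I, GGS_conjecture (F i)) /\
  (twist_conjecture T <-> forall i : I, twist_conjecture (F i)).
Proof.
(* For both forward directions the hypothesis on [T] is evaluated at this solution and restricted to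
   [F i]; a given solution for [F i] need not solve the system for [T]. *)
have [r1 r1T] := r0_solution_exists T.
have [s1 e1 s1_anti] := in_wedge_hE r1T.1; rewrite {r1}e1 in r1T.
split; split.
- move=> gT i r rF; have [yb he] := gT _ r1T; have r1F := r0_solution_union hTF i r1T.
  have [cY cH] := GGS_change_r0 r1F rF; have [rY rH] := GGS_restrict hTF s1 i.
  by split; [exact/cY/rY | exact/cH/rH].
- move=> gF r rT; have rF i := r0_solution_union hTF i rT.
  have [s e s_anti] := in_wedge_hE rT.1; subst r.
  have [cY cH] := GGS_combine hTF s_anti.
  by split; [apply: cY | apply: cH] => i; case: (gF i _ (rF i)).
- move=> tT i r rF; have [yb JG] := tT _ r1T; have r1F := r0_solution_union hTF i r1T.
  have [cY _] := GGS_change_r0 r1F rF; have [rY _] := GGS_restrict hTF s1 i.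
  have JGF : R_J (F i) r = R_GGS (F i) r.
    by have e := R_J_restrict hTF i JG; rewrite /R_J /R_GGS e; reflexivity.
  (* The QYBE for [R_J] passes through [R_GGS], for which the change of solution has been
     established. *)
  by split; [rewrite JGF; apply/cY/rY; rewrite -JG | exact: JGF].
move=> tF r rT; have rF i := r0_solution_union hTF i rT.
have [s e s_anti] := in_wedge_hE rT.1; subst r.
have JG : R_J T (diag2 s) = R_GGS T (diag2 s).
  by apply: (R_J_combine hTF) => i; case: (tF i _ (rF i)).
have [cY _] := GGS_combine hTF s_anti.
split; last exact: JG.
by rewrite JG; apply: cY => i; case: (tF i _ (rF i)) => yb <-.
Qed.
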